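(* There exist finite simple connected cubic graphs, on as few as $16$ vertices, that have identical adjacency/Laplacian spectra, spanning tree counts, order, girth, diameter, vertex and edge connectivity, automorphism-group order, and cycle counts through length $10$, yet have pairwise distinct orientable genus polynomials. In particular, the genus polynomial of a cubic graph is not determined by its spectrum.
   Context: Cubic means $3$-regular. The order of a graph is its number of vertices, and its girth is the length of a shortest cycle. The adjacency spectrum is the multiset of eigenvalues of the adjacency matrix $A$, and the Laplacian spectrum is that of $D-A$, where $D$ is the diagonal matrix of degrees. The cycle counts through length $10$ are the numbers $c_k(G)$ for $k\le 10$, where $c_k(G)$ is the number of cycles of length $k$ in $G$; a cycle is an unoriented closed walk through $k$ distinct vertices, with cyclic shifts not distinguished. Genus polynomial. A dart of $G$ is an ordered pair $(u,v)$ with $uv\in E(G)$. A rotation system $\rho$ of $G$ assigns to each vertex $v$ a cyclic ordering of its neighbours; $\sigma_v(u)$ denotes the neighbour of $v$ following $u$ in this ordering. The face permutation of $\rho$ on darts is $\phi_\rho(u,v)=(v,\sigma_v(u))$; its cycles are the faces of $\rho$, and $F(\rho)$ is their number. A connected cubic graph on $n$ vertices has exactly $2^n$ rotation systems, each describing a cellular embedding in an orientable surface, whose genus is given by Euler's formula as $g(\rho)=1+\frac n4-\frac12F(\rho)$. The orientable genus polynomial of $G$ (also called simply its genus polynomial) is $\Gamma_G(x)=\sum_{g\ge0}N_g(G)x^g$, where $N_g(G)$ is the number of rotation systems $\rho$ of $G$ with $g(\rho)=g$. *)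

(* Defs.v *)
From mathcomp Require Import all_boot all_order all_fingroup all_algebra all_field.

Set Implicit Arguments.
Unset Strict Implicit.
Unset Printing Implicit Defensive.

Import GRing.Theory.

(* Edge relations on a finite type; edge and vertex deletions of a graph are
   again presented as such relations. *)

Section Relations.
Variables (T : finType) (e : rel T).

Definition connected : bool :=
  (0 < #|T|) && [forall x, forall y, connect e x y].

(* The closed walks equal to t up to cyclic shift and reversal. *)
Definition cycle_class k (t : k.-tuple T) : {set k.-tuple T} :=
  [set s : k.-tuple T | [exists i : 'I_k,
     (tval s == rot i t) || (tval s == rot i (rev t))]].

(* The guard 3 <= k is needed because ucycleb accepts the empty sequence and
   the sequence [:: x; y] going back and forth along one edge. *)
Definition cycles k : {set {set k.-tuple T}} :=
  [set cycle_class t | t : k.-tuple T & (3 <= k) && ucycleb e t].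

Definition cycle_count k : nat := #|cycles k|.

Definition acyclic : bool := [forall k : 'I_#|T|.+1, cycle_count k == 0].

Definition is_tree : bool := connected && acyclic.

End Relations.

Record sgraph := SGraph {
  vertex :> finType;
  adjacent : rel vertex;
  adjacent_sym : symmetric adjacent;
  adjacent_irrefl : irreflexive adjacent
}.

Section Graphs.
Variable G : sgraph.

Definition neighbours (v : G) : {set G} := [set u | adjacent v u].
Definition degree (v : G) : nat := #|neighbours v|.
Definition cubic : bool := [forall v : G, degree v == 3].

Definition edges : {set {set G}} :=
  [set [set p.1; p.2] | p : G * G & adjacent p.1 p.2].

(* Meant for F \subset edges. *)
Definition edge_subset_rel (F : {set {set G}}) : rel G :=
  [rel u v | [set u; v] \in F].

Definition spanning_tree_count : nat :=
  #|[set F : {set {set G}} | (F \subset edges) && is_tree (edge_subset_rel F)]|.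

(* Every cycle has length at most #|G|; the value is #|G|.+1 if there is no
   cycle. *)
Definition girth : nat :=
  find (fun k => 0 < cycle_count (@adjacent G) k) (iota 0 #|G|.+1).

(* The value is #|G| if v cannot be reached from u. *)
Definition distance (u v : G) : nat :=
  find (fun k => [exists p : k.-tuple G,
                    path (@adjacent G) u p && (last u p == v)])
       (iota 0 #|G|).

Definition diameter : nat := \max_(u : G) \max_(v : G) distance u v.

Definition vertex_cut (S : {set G}) : bool :=
  (#|~: S| <= 1) ||
  ~~ [forall u in ~: S, forall v in ~: S,
        connect [rel x y | [&& x \notin S, y \notin S & adjacent x y]] u v].

Definition vertex_connectivity : nat :=
  #|[arg min_(S < [set: G] | vertex_cut S) #|S|]|.

Definition edge_cut (F : {set {set G}}) : bool :=
  (F \subset edges) && ~~ connected (edge_subset_rel (edges :\: F)).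

(* The set of all edges is an edge cut as soon as G has two vertices. *)
Definition edge_connectivity : nat :=
  #|[arg min_(F < edges | edge_cut F) #|F|]|.

Definition automorphisms : {set {perm G}} :=
  [set p : {perm G} | [forall u, forall v,
     adjacent (p u) (p v) == adjacent u v]].

Local Open Scope ring_scope.

Definition adjacency_matrix : 'M[algC]_#|G| :=
  \matrix_(i, j) (adjacent (enum_val i) (enum_val j))%:R.

Definition degree_matrix : 'M[algC]_#|G| :=
  diag_mx (\row_i (degree (enum_val i))%:R).

Definition laplacian_matrix : 'M[algC]_#|G| := degree_matrix - adjacency_matrix.

End Graphs.

(* The eigenvalues with multiplicity, in an unspecified order: spectra are to
   be compared with perm_eq. *)
Definition spectrum n (M : 'M[algC]_n) : seq algC :=
  sval (closed_field_poly_normal (char_poly M)).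

Lemma spectrumP n (M : 'M[algC]_n) :
  char_poly M = (\prod_(a <- spectrum M) ('X - a%:P))%R.
Proof.
rewrite /spectrum; case: closed_field_poly_normal => r /= {1}->.
by rewrite (eqP (char_poly_monic M)) scale1r.
Qed.

Definition adjacency_spectrum (G : sgraph) : seq algC :=
  spectrum (adjacency_matrix G).
Definition laplacian_spectrum (G : sgraph) : seq algC :=
  spectrum (laplacian_matrix G).

Section Genus.
Variable G : sgraph.

(* rho v u is the neighbour of v following u.  A cyclic ordering of the
   neighbours of v is a permutation that is a single cycle on them; fixing
   all other vertices makes it unique as a permutation of G. *)
Definition rotation_system (rho : {ffun G -> {perm G}}) : bool :=
  [forall v, perm_on (neighbours v) (rho v) &&
     [forall u in neighbours v, porbit (rho v) u == neighbours v]].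

Definition darts : {set G * G} := [set d | adjacent d.1 d.2].

Definition face_map (rho : {ffun G -> {perm G}}) (d : G * G) : G * G :=
  (d.2, rho d.2 d.1).

Lemma face_map_inj rho : injective (face_map rho).
Proof. by move=> [u v] [u' v'] [/= <- /perm_inj ->]. Qed.

Definition face_perm rho : {perm G * G} := perm (@face_map_inj rho).

Lemma face_perm_darts rho d :
  rotation_system rho -> (face_perm rho d \in darts) = (d \in darts).
Proof.
move=> /forallP/(_ d.2)/andP[onN _].
rewrite permE !inE /= (adjacent_sym d.1).
by have := perm_closed d.1 onN; rewrite !inE.
Qed.

Definition faces rho : {set {set G * G}} :=
  [set porbit (face_perm rho) d | d in darts].

Local Open Scope ring_scope.

(* Euler's formula n - 3n/2 + F = 2 - 2g for a connected cubic graph. *)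
Definition genus rho : rat := 1 + #|G|%:R / 4 - #|faces rho|%:R / 2.

Definition genus_count (g : nat) : nat :=
  #|[set rho | rotation_system rho & genus rho == g%:R]|.

(* The truncation is harmless, since genus rho <= 1 + #|G| / 4. *)
Definition genus_polynomial : {poly int} :=
  \poly_(g < #|G|.+2) (genus_count g)%:R.

End Genus.

(* Main.v *)
From HB Require Import structures.
Require Import Defs.
From Stdlib Require Import BinNums BinNat Nnat.
From mathcomp Require Import all_boot all_order all_fingroup all_algebra all_field.
From mathcomp Require Import lra.

Set Implicit Arguments.
Unset Strict Implicit.
Unset Printing Implicit Defensive.

(** The two graphs share their sixteen vertices and twenty of their
    twenty-four edges.  Both contain the pentagons 1-2-3-5-4 and 9-10-13-11-12.
    In the graph called toroidal, vertex 0 is joined to 3 and 11 and vertex 6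
    to 5 and 10; in the graph called nontoroidal, 0 is joined to 5 and 10 and
    6 to 3 and 11.

    They are cospectral because a rational orthogonal matrix conjugates one
    adjacency matrix into the other.  Five times this matrix has integer
    entries, so the similarity amounts to two identities between integer
    matrices (intertwiner_orth, intertwiner_twines).  Both graphs being cubic,
    the same matrix conjugates their Laplacians.

    Their genus polynomials differ in the coefficient of x.  By Euler's
    formula a rotation system on sixteen vertices has genus 1 exactly when it
    has eight faces.  One graph embeds in the torus, and such a rotation
    system is exhibited for it; the other does not, and all its 65536 rotation
    systems must be excluded.  They are treated together, one vertex at a
    time.  Once the rotations at some vertices are fixed, the face permutation
    is known on the darts that enter these vertices, and only two data
    influence the final number of faces: how many faces are already closed,
    and which are the two ends of every unfinished one.  Rotation systems that
    agree in these data are merged, which leaves a few hundred states at a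
    time (traced_link, rotation_embedded).

    The other invariants are evaluated on each graph, after each has been
    related to a finite search that can be run: closures of a vertex under
    adjacency for the connectivities (spans_connect), enumeration of paths for
    the cycle counts, where a cycle of length k is met 2k times
    (card_ucycles), extension of partial isomorphisms for the automorphisms
    (automorphism_copy), and deletion and contraction of edges, again with
    merged states, for the spanning trees (tree_count_forests). *)

(** * Cospectral cubic graphs *)

Section Spectra.
Import GRing.Theory.
Local Open Scope ring_scope.

(** The determinant of P cancels from det ((X - A) P) = det (P (X - B)). *)
Lemma char_poly_similar (F : fieldType) n (A B P : 'M[F]_n) :
  P \in unitmx -> A *m P = P *m B -> char_poly A = char_poly B.
Proof.
move=> uP AP.
pose Q := map_mx (@polyC F) P.
have uQ : \det Q != 0.
  by rewrite det_map_mx polyC_eq0; move: uP; rewrite unitmxE unitfE.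
apply: (mulIf uQ); rewrite /char_poly -det_mulmx [RHS]mulrC -det_mulmx.
congr (\det _); rewrite /char_poly_mx mulmxBl mulmxBr -!map_mxM AP.
by rewrite -scalar_mxC.
Qed.

Lemma perm_spectrum n (A B : 'M[algC]_n) :
  char_poly A = char_poly B -> perm_eq (spectrum A) (spectrum B).
Proof.
by move=> AB; apply: prod_XsubC_eq; rewrite -!spectrumP.
Qed.

(** Functions of two vertices stand for integer matrices: their products are
    sums over the vertices, which can be evaluated, whereas matrices are indexed
    by the opaque enumeration of the vertex type. *)
Definition int_mx (T : finType) (f : T -> T -> int) : 'M[algC]_#|T| :=
  \matrix_(i, j) (f (enum_val i) (enum_val j))%:~R.

Lemma int_mxM (T : finType) (f g : T -> T -> int) :
  int_mx f *m int_mx g = int_mx (fun x z => \sum_y f x y * g y z).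
Proof.
apply/matrixP=> i j; rewrite !mxE rmorph_sum /=.
rewrite (reindex (@enum_val T predT)) /=; last first.
  by exists enum_rank => x _; [apply: enum_valK | apply: enum_rankK].
by apply: eq_bigr => k _; rewrite !mxE intrM.
Qed.

Lemma eq_int_mx (T : finType) (f g : T -> T -> int) :
  f =2 g -> int_mx f = int_mx g.
Proof. by move=> fg; apply/matrixP=> i j; rewrite !mxE fg. Qed.

Lemma adjacency_int_mx (G : sgraph) :
  adjacency_matrix G = int_mx (fun u v : G => (adjacent u v)%:R).
Proof. by apply/matrixP=> i j; rewrite !mxE /=; case: adjacent. Qed.

Section Intertwining.
Variables (T : finType) (a b : rel T).
Hypotheses (sa : symmetric a) (ia : irreflexive a).
Hypotheses (sb : symmetric b) (ib : irreflexive b).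
Let G := SGraph sa ia.
Let H := SGraph sb ib.
Variables (p : T -> T -> int) (d : int).
Hypothesis d_neq0 : d != 0.
Hypothesis p_orth : forall x z, \sum_y p x y * p z y = d *+ (x == z).
Hypothesis p_twine :
  forall x z, \sum_y (a x y)%:R * p y z = \sum_y p x y * (b y z)%:R.

(** The matrix of p is a multiple of an orthogonal matrix, so its transpose is
    its inverse up to the scalar d. *)
Lemma intertwiner_unit : int_mx p \in unitmx.
Proof.
have PPT : int_mx p *m ((d%:~R)^-1 *: int_mx (fun x y => p y x)) = 1%:M.
  rewrite -scalemxAr int_mxM (eq_int_mx p_orth).
  apply/matrixP=> i j; rewrite !mxE (inj_eq enum_val_inj) rmorphMn /=.
  by rewrite mulrnAr mulVf // intr_eq0.
by have [] := mulmx1_unit PPT.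
Qed.

Lemma intertwined_adjacency :
  adjacency_matrix G *m int_mx p = int_mx p *m adjacency_matrix H.
Proof. by rewrite !adjacency_int_mx !int_mxM; apply: eq_int_mx. Qed.

Lemma adjacency_cospectral :
  perm_eq (adjacency_spectrum G) (adjacency_spectrum H).
Proof.
apply: perm_spectrum.
exact: char_poly_similar intertwiner_unit intertwined_adjacency.
Qed.

Lemma cubic_laplacian (K : sgraph) :
  cubic K -> laplacian_matrix K = 3%:M - adjacency_matrix K.
Proof.
move=> /forallP cK; congr (_ - _); apply/matrixP=> i j; rewrite !mxE.
by rewrite (eqP (cK _)).
Qed.

Lemma laplacian_cospectral :
  cubic G -> cubic H -> perm_eq (laplacian_spectrum G) (laplacian_spectrum H).
Proof.
move=> cG cH; apply: perm_spectrum; apply: char_poly_similar intertwiner_unit _.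
rewrite !cubic_laplacian // mulmxBl mulmxBr intertwined_adjacency.
by rewrite -scalar_mxC.
Qed.
End Intertwining.
End Spectra.

(** * Vertex and edge connectivity *)

Section Reachability.
Variable T : finType.

Definition spread (nb : T -> seq T) (s : seq T) : seq T :=
  undup (s ++ flatten (map nb s)).

Lemma spread_connect (e : rel T) nb r k v :
  (forall u w, w \in nb u -> e u w) ->
  v \in iter k (spread nb) [:: r] -> connect e r v.
Proof.
move=> nbe; elim: k v => [|k IHk] v /=.
  by rewrite inE => /eqP->; apply: connect0.
rewrite mem_undup mem_cat => /orP[/IHk //|/flatten_mapP[u /IHk ru /nbe uv]].
exact: connect_trans ru (connect1 uv).
Qed.

(** The relation bad marks the links that are removed, and keep the vertices
    that must be reached from the first of them.  The number k of rounds need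
    only be large enough for the test to succeed. *)
Definition spans (vs : seq T) (nb : T -> seq T) (bad : rel T) (keep : pred T) k :
    bool :=
  if [seq v <- vs | keep v] is r :: ws then
    let R := iter k (spread (fun u => [seq v <- nb u | ~~ bad u v])) [:: r] in
    all (mem R) ws
  else true.

Lemma spans_connect vs nb (bad e : rel T) (A : pred T) k :
  vs =i T -> symmetric e ->
  (forall u v, v \in nb u -> ~~ bad u v -> e u v) ->
  spans vs nb bad A k -> {in A &, forall u v, connect e u v}.
Proof.
move=> vsT se nbe; rewrite /spans.
have memA u : u \in A -> u \in [seq v <- vs | A v].
  by move=> Au; rewrite mem_filter vsT andbT.
case def_ws: [seq v <- vs | A v] memA => [|r ws] memA.
  by move=> _ u v /memA.
move=> /allP ws_r.
have r_to u : u \in A -> connect e r u.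
  move/memA; rewrite inE => /orP[/eqP->|/ws_r]; first exact: connect0.
  apply: spread_connect => x y; rewrite mem_filter => /andP[nbad nby].
  exact: nbe nby nbad.
move=> u v Au Av; apply: connect_trans (r_to v Av).
by rewrite (sym_connect_sym se) r_to.
Qed.
End Reachability.

Lemma card_le2 (A : finType) (S : {set A}) :
  #|S| <= 2 -> S = set0 \/ exists x y, S = [set x; y].
Proof.
rewrite leq_eqVlt ltnS leq_eqVlt ltnS leqn0.
case/or3P=> [/cards2P[x [y [_ ->]]]|/cards1P[x ->]|].
- by right; exists x, y.
- by right; exists x, x; rewrite setUid.
by rewrite cards_eq0 => /eqP; left.
Qed.

Lemma connect_isolated (A : finType) (e : rel A) x y :
  (forall z, ~~ e x z) -> connect e x y = (x == y).
Proof.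
move=> ex; apply/idP/eqP=> [/connectP[[|z p] /=]|->]; rewrite ?connect0 //.
by rewrite (negPf (ex z)).
Qed.

Lemma isolated_disconnects (A : finType) (e : rel A) x :
  1 < #|A| -> (forall z, ~~ e x z) -> ~~ connected e.
Proof.
move=> A_gt1 ex; rewrite negb_and; apply/orP; right.
have: 0 < #|~: [set x]| by rewrite cardsCs setCK cards1 subn_gt0.
case/card_gt0P=> y; rewrite !inE => yx.
apply/forallPn; exists x; apply/forallPn; exists y.
by rewrite connect_isolated 1?eq_sym.
Qed.

Lemma eq_set2 (A : finType) (a b c d : A) :
  ([set a; b] == [set c; d]) = (a == c) && (b == d) || (a == d) && (b == c).
Proof.
apply/eqP/orP=> [/setP E|[]/andP[/eqP-> /eqP->] //]; last exact: setUC.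
have /orP[/eqP Ea|/eqP Ea]: (a == c) || (a == d).
    by have:= E a; rewrite !inE eqxx => <-.
  subst c; have:= E b; have:= E d; rewrite !inE !eqxx ?orbT => /orP[]/eqP->.
    by rewrite ?orbT orbb => /esym/eqP->; left; rewrite eqxx.
  by left; rewrite !eqxx.
subst d; have:= E b; have:= E c; rewrite !inE !eqxx ?orbT => /orP[]/eqP->.
  by rewrite ?orbT orbb => /esym/eqP->; right; rewrite eqxx.
by right; rewrite !eqxx.
Qed.

Lemma mem_edges (G : sgraph) (u v : G) : ([set u; v] \in edges G) = adjacent u v.
Proof.
apply/imsetP/idP=> [[[a b]]|uv]; last by exists (u, v); rewrite ?inE.
rewrite inE /= => ab /eqP; rewrite eq_set2.
by case/orP=> /andP[/eqP-> /eqP->]; rewrite // adjacent_sym.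
Qed.

Section HalfEdges.
Variables (G : sgraph) (vs : seq G) (nb : G -> seq G).
Hypothesis vsG : vs =i G.
Hypothesis nbG : forall u v, (v \in nb u) = adjacent u v.

Definition half_edges : seq (G * G) :=
  [seq p <- [seq (u, v) | u <- vs, v <- nb u] | index p.1 vs < index p.2 vs].

Lemma mem_half_edges u v :
  ((u, v) \in half_edges) = adjacent u v && (index u vs < index v vs).
Proof.
rewrite mem_filter andbC; congr (_ && _).
apply/allpairsPdep/idP=> [[x [y [_ xy [-> ->]]]]|uv]; first by rewrite -nbG.
by exists u, v; rewrite vsG nbG.
Qed.

Lemma half_edges_orient u v :
  adjacent u v = ((u, v) \in half_edges) || ((v, u) \in half_edges).
Proof.
rewrite !mem_half_edges (adjacent_sym v) -andb_orr.
case uv: (adjacent u v) => //=; apply/esym; rewrite -neq_ltn.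
apply: contraFN (adjacent_irrefl u) => /eqP/index_inj uv_eq.
by rewrite {2}uv_eq ?vsG.
Qed.

Lemma edges_half a :
  a \in edges G -> exists2 p, p \in half_edges & a = [set p.1; p.2].
Proof.
case/imsetP=> -[u v]; rewrite inE /= half_edges_orient => /orP[] uv ->.
  by exists (u, v).
by exists (v, u); rewrite // setUC.
Qed.
End HalfEdges.

Section Connectivity.
Variables (G : sgraph) (vs : seq G) (nb : G -> seq G).
Hypothesis vsG : vs =i G.
Hypothesis nbG : forall u v, (v \in nb u) = adjacent u v.

Definition no_link : rel G := fun _ _ => false.

Lemma connected_by_spans k :
  0 < #|G| -> spans vs nb no_link xpredT k -> connected (@adjacent G).
Proof.
move=> G_gt0 ok; rewrite /connected G_gt0 /=.
apply/forallP=> u; apply/forallP=> v.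
apply: (spans_connect vsG (@adjacent_sym G) _ ok) => // x y.
by rewrite nbG.
Qed.

Lemma card_neighbours (v : G) : cubic G -> #|neighbours v| = 3.
Proof. by move=> /forallP/(_ v)/eqP. Qed.

Lemma vertex_cut_neighbours (v : G) :
  cubic G -> 4 < #|G| -> vertex_cut (neighbours v).
Proof.
move=> cG G_gt4; apply/orP; right.
have vNv : v \notin neighbours v by rewrite inE adjacent_irrefl.
have: 0 < #|~: (v |: neighbours v)|.
  by rewrite cardsCs setCK cardsU1 vNv card_neighbours // subn_gt0.
case/card_gt0P=> u; rewrite !inE negb_or => /andP[uv uNv].
apply/forall_inPn; exists v; first by rewrite inE.
apply/forall_inPn; exists u; first by rewrite !inE.
rewrite connect_isolated 1?eq_sym // => z /=.
by rewrite !inE; case: (adjacent v z); rewrite ?andbF.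
Qed.

(** Taking x = y covers the sets with one element. *)
Definition vertex_check k :=
  all (fun x => all (fun y =>
    spans vs nb (fun u v => (u \in [:: x; y]) || (v \in [:: x; y]))
      (fun v => v \notin [:: x; y]) k) vs) vs.

(** The three neighbours of a vertex cut it off, so that only the sets with at
    most two elements have to be excluded. *)
Lemma vertex_connectivity3 k :
  cubic G -> 4 < #|G| -> connected (@adjacent G) -> vertex_check k ->
  vertex_connectivity G = 3.
Proof.
move=> cG G_gt4 /andP[_ /forallP conG] ok; rewrite /vertex_connectivity.
have cutT : vertex_cut [set: G] by rewrite /vertex_cut setCT cards0.
case: arg_minnP => // S cutS minS; apply/eqP; rewrite eqn_leq.
have [v _] : exists v, v \in G by apply/card_gt0P; apply: leq_trans G_gt4.
rewrite -{1}(card_neighbours v cG) minS ?vertex_cut_neighbours //=.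
rewrite ltnNge; apply: contraL cutS => S_le2.
rewrite negb_or -ltnNge cardsCs setCK ltn_subRL.
rewrite (leq_trans _ G_gt4) /= ?addn1 ?ltnS ?(leq_trans S_le2) // negbK.
apply/forall_inP=> u uS; apply/forall_inP=> w wS.
case: (card_le2 S_le2) uS wS => [->|[x [y ->]]] uS wS.
  rewrite (@eq_connect _ _ (@adjacent G)) ?(forallP (conG u)) // => a b.
  by rewrite /= !inE.
have okxy := allP (allP ok x (etrans (vsG x) isT)) y (etrans (vsG y) isT).
apply: (spans_connect vsG _ _ okxy); rewrite ?unfold_in -?in_setC //=.
- by move=> a b /=; rewrite adjacent_sym andbCA.
- by move=> a b; rewrite nbG /= !inE negb_or => -> /andP[-> ->].
- by move: uS; rewrite !inE orbF.
by move: wS; rewrite !inE orbF.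
Qed.

Lemma card_edges_at (v : G) :
  #|[set [set v; u] | u in neighbours v]| = #|neighbours v|.
Proof.
apply: card_in_imset => x y; rewrite !inE => vx vy /setP/(_ x).
rewrite !inE eqxx orbT; case: (x =P v) => [xv|_ /esym/eqP//].
by rewrite xv adjacent_irrefl in vx.
Qed.

Lemma edge_cut_at (v : G) :
  1 < #|G| -> edge_cut [set [set v; u] | u in neighbours v].
Proof.
move=> G_gt1; apply/andP; split.
  by apply/subsetP=> _ /imsetP[u uv ->]; rewrite mem_edges; rewrite inE in uv.
apply: (isolated_disconnects (x := v)) G_gt1 _ => z.
rewrite /edge_subset_rel /= inE mem_edges.
case vz: (adjacent v z); rewrite ?andbF // andbT negbK.
by apply/imsetP; exists z; rewrite ?inE.
Qed.

Definition edge_check k :=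
  let E := half_edges vs nb in
  all (fun x => all (fun y =>
    spans vs nb (fun u v => ((u, v) \in [:: x; y]) || ((v, u) \in [:: x; y]))
      xpredT k) E) E.

(** The three edges at a vertex form a cut, so that only the sets with at most
    two edges have to be excluded. *)
Lemma edge_connectivity3 k :
  cubic G -> 4 < #|G| -> connected (@adjacent G) -> edge_check k ->
  edge_connectivity G = 3.
Proof.
move=> cG G_gt4 conG ok; rewrite /edge_connectivity.
have [v _] : exists v, v \in G by apply/card_gt0P; apply: leq_trans G_gt4.
have G_gt1 : 1 < #|G| by apply: leq_trans G_gt4.
have cutv := edge_cut_at v G_gt1.
have cutE : edge_cut (edges G).
  rewrite /edge_cut subxx /= setDv.
  apply: (isolated_disconnects (x := v)) => // z.
  by rewrite /edge_subset_rel /= inE.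
case: arg_minnP => // F cutF minF; apply/eqP; rewrite eqn_leq.
rewrite -{1}(card_neighbours v cG) -(card_edges_at v) minF //=.
rewrite ltnNge; apply: contraL cutF => F_le2.
rewrite /edge_cut negb_and negbK; case: (boolP (F \subset _)) => //= /subsetP FE.
case: (card_le2 F_le2) FE => [->|[x [y ->]]] FE.
  rewrite setD0 (_ : connected _ = connected (@adjacent G)) //.
  rewrite /connected; congr (_ && _); apply: eq_forallb => a.
  apply: eq_forallb => b; apply: eq_connect => c d.
  by rewrite /edge_subset_rel /= mem_edges.
have /(edges_half vsG nbG)[[x1 x2] Ex def_x] : x \in edges G.
  by rewrite FE // !inE eqxx.
have /(edges_half vsG nbG)[[y1 y2] Ey def_y] : y \in edges G.
  by rewrite FE // !inE eqxx orbT.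
have okxy := allP (allP ok _ Ex) _ Ey.
rewrite /connected (leq_trans _ G_gt4) //=.
apply/forallP=> a; apply/forallP=> b.
apply: (spans_connect vsG _ _ okxy) => // c d; rewrite /edge_subset_rel /=.
  by rewrite setUC.
rewrite /edge_subset_rel nbG /= !inE mem_edges => -> /=; rewrite andbT.
rewrite def_x def_y !eq_set2 !xpair_eqE.
rewrite (andbC (d == x1)) (andbC (d == y1)).
by move: (_ && _) (_ && _) (_ && _) (_ && _) => [] [] [] [].
Qed.
End Connectivity.

(** * Diameter *)

Section Diameter.
Variables (G : sgraph) (vs : seq G) (nb : G -> seq G).
Hypothesis vs_uniq : uniq vs.
Hypothesis vsG : vs =i G.
Hypothesis nbG : forall u v, (v \in nb u) = adjacent u v.

Definition walk_ends k (u : G) : seq G :=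
  iter k (fun s => undup (flatten (map nb s))) [:: u].

(** Keeping only the ends of the walks avoids the search over all tuples of
    vertices by which distances are defined. *)
Lemma walk_endsP k u v :
  reflect (exists2 p, size p = k & path (@adjacent G) u p && (last u p == v))
          (v \in walk_ends k u).
Proof.
elim: k v => [|k IHk] v /=.
  rewrite inE eq_sym; apply: (iffP idP) => [uv|[[|//] _ /andP[_ ->]]] //.
  by exists [::].
rewrite mem_undup; apply: (iffP flatten_mapP) => [[w /IHk[p p_k]]|].
  case/andP=> up /eqP up_w; rewrite nbG => wv; exists (rcons p v).
    by rewrite size_rcons p_k.
  by rewrite rcons_path last_rcons up up_w wv eqxx.
case=> p; case/lastP: p => // p w; rewrite size_rcons => -[p_k].
rewrite rcons_path last_rcons => /andP[/andP[up wv] /eqP <-].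
by exists (last u p); [apply/IHk; exists p; rewrite ?up /= | rewrite nbG].
Qed.

Definition dist n (u v : G) : nat :=
  find (fun k => v \in walk_ends k u) (iota 0 n).

Lemma distanceE u v : distance u v = dist #|G| u v.
Proof.
apply: eq_find => k; apply/existsP/walk_endsP=> [[p up]|[p p_k up]].
  by exists p; rewrite ?size_tuple.
by case: k / p_k; exists (in_tuple p).
Qed.

Definition maximum (f : G -> nat) : nat := foldr maxn 0 (map f vs).

Lemma maximumE (f : G -> nat) : \max_(u : G) f u = maximum f.
Proof.
rewrite /maximum (eq_bigl (mem vs)) => [|u]; last by rewrite /= vsG.
rewrite -big_uniq //; elim: (vs) => [|v s IHs]; first by rewrite big_nil.
by rewrite big_cons IHs.
Qed.

Lemma diameterE : diameter G = maximum (fun u => maximum (dist #|G| u)).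
Proof.
rewrite /diameter -maximumE; apply: eq_bigr => u _.
by rewrite -maximumE; apply: eq_bigr => v _; rewrite distanceE.
Qed.
End Diameter.

(** * Cycle counts *)

Section Growth.
Variables (T : eqType) (ext : seq T -> seq T).

(** Sequences are built from their last item to their first one: ext s lists
    the items that may be put in front of s. *)
Definition grow k : seq (seq T) :=
  iter k (fun L => [seq x :: s | s <- L, x <- ext s]) [:: [::]].

Fixpoint admissible (s : seq T) : bool :=
  if s is x :: s' then (x \in ext s') && admissible s' else true.

Lemma mem_grow k s : (s \in grow k) = (size s == k) && admissible s.
Proof.
elim: k s => [|k IHk] s /=; first by rewrite inE; case: s.
apply/allpairsPdep/idP=> [[s' [x [s'k xs' ->]]] /=|].
  by move: s'k; rewrite IHk => /andP[/eqP-> ->]; rewrite eqxx xs'.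
case: s => // x s /= /andP[s_k /andP[xs adm]].
by exists s, x; split=> //; rewrite IHk -eqSS s_k.
Qed.

Lemma grow_uniq k : (forall s, uniq (ext s)) -> uniq (grow k).
Proof.
move=> ext_uniq; elim: k => //= k IHk.
apply: allpairs_uniq_dep => // [[s x] [s' x']] _ _ /= [-> ->].
by [].
Qed.
End Growth.

Section CycleClasses.
Variables (T : finType) (e : rel T) (k : nat).
Hypothesis e_sym : symmetric e.
Hypothesis k_ge3 : 2 < k.
Implicit Types s t : k.-tuple T.

Let D := [set t : k.-tuple T | ucycleb e t].

Lemma cycle_classP t s :
  reflect (exists i, tval s = rot i t \/ tval s = rot i (rev t))
          (s \in cycle_class t).
Proof.
rewrite inE; apply: (iffP existsP) => [[i /orP[]/eqP->]|[i st]].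
- by exists i; left.
- by exists i; right.
case: (ltnP i k) => [lt_ik|le_ki].
  by exists (Ordinal lt_ik); case: st => ->; rewrite eqxx ?orbT.
have k_gt0 : 0 < k by apply: leq_trans k_ge3.
exists (Ordinal k_gt0); rewrite !rot0.
by case: st => ->; rewrite rot_oversize ?size_rev ?size_tuple // eqxx ?orbT.
Qed.

Lemma rot_rot_exists m n (p : seq T) : exists i, rot m (rot n p) = rot i p.
Proof.
case: (leqP (size p) m) => [le_pm|/ltnW le_mp].
  by exists n; rewrite rot_oversize ?size_rot.
case: (leqP (size p) n) => [le_pn|/ltnW le_np].
  by exists m; rewrite (rot_oversize le_pn).
by rewrite rot_add_mod //; case: ifP => _; eexists.
Qed.

Lemma rev_rot_exists n (p : seq T) : exists i, rev (rot n p) = rot i (rev p).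
Proof. by rewrite rev_rot /rotr; eexists. Qed.

Lemma cycle_class_refl t : t \in cycle_class t.
Proof. by apply/cycle_classP; exists 0; left; rewrite rot0. Qed.

Lemma rot_inverse n (p : seq T) : exists i, p = rot i (rot n p).
Proof. by exists (size (rot n p) - n); rewrite -{1}(rotK n p). Qed.

Lemma cycle_class_sym s t : s \in cycle_class t -> t \in cycle_class s.
Proof.
case/cycle_classP=> i [] st; apply/cycle_classP.
  by have [j tj] := rot_inverse i t; exists j; left; rewrite st.
have [n en] := rev_rot_exists i (rev t); rewrite revK -st in en.
by have [j tj] := rot_inverse n t; exists j; right; rewrite en.
Qed.

Lemma cycle_class_trans s t u :
  s \in cycle_class t -> u \in cycle_class s -> u \in cycle_class t.
Proof.
case/cycle_classP=> i st /cycle_classP[j us]; apply/cycle_classP.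
case: us => ->; case: st => ->.
- by have [m ->] := rot_rot_exists j i t; exists m; left.
- by have [m ->] := rot_rot_exists j i (rev t); exists m; right.
- have [n ->] := rev_rot_exists i t.
  by have [m ->] := rot_rot_exists j n (rev t); exists m; right.
have [n ->] := rev_rot_exists i (rev t); rewrite revK.
by have [m ->] := rot_rot_exists j n t; exists m; left.
Qed.

Lemma cycle_class_sub t : t \in D -> cycle_class t \subset D.
Proof.
rewrite inE => /andP[ct ut]; apply/subsetP=> s /cycle_classP[i st].
have rev_e : (fun x y => e y x) =2 e by move=> x y; rewrite e_sym.
rewrite inE /ucycleb; case: st => ->; rewrite rot_cycle rot_uniq.
  by rewrite ct ut.
by rewrite rev_cycle (eq_cycle rev_e) ct rev_uniq ut.
Qed.

(** The rotations of a sequence without repetition have different first items.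
    None of them is a rotation of the mirror image, because reversal exchanges
    the successor and the predecessor of a vertex, which differ when 2 < k. *)
Lemma card_cycle_class t : uniq t -> #|cycle_class t| = 2 * k.
Proof.
case: t => -[|x0 [|x1 [|x2 p]]] sz_t ut;
  do 1?[by move: (k_ge3); rewrite -{1}(eqP sz_t)].
set t := Tuple sz_t in ut *.
pose f (bi : bool * 'I_k) : k.-tuple T :=
  if bi.1 then [tuple of rot bi.2 (rev t)] else [tuple of rot bi.2 t].
have nth_rot (q : seq T) i :
    size q = k -> i < k -> nth x0 (rot i q) 0 = nth x0 q i.
  by move=> qk ik; rewrite /rot nth_cat size_drop qk subn_gt0 ik nth_drop addn0.
have rot_eq (q : seq T) (i j : 'I_k) :
    uniq q -> size q = k -> rot i q = rot j q -> i = j.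
  move=> uq qk /(congr1 (fun r => nth x0 r 0)); rewrite !nth_rot // => /eqP.
  by rewrite nth_uniq ?qk // => /eqP/val_inj.
have no_mirror i j : rot i t <> rot j (rev t).
  move=> /(congr1 (fun r => next r x1)); rewrite !next_rot ?rev_uniq //.
  rewrite next_rev //.
  move: ut => /and3P[]; rewrite !inE !negb_or => /and3P[x01 x02 _] _ _.
  rewrite /= (eq_sym x1) (negPf x01) eqxx => x20.
  by rewrite x20 eqxx in x02.
have f_inj : injective f.
  move=> [b i] [c j] /(congr1 val); rewrite /f; case: b; case: c => /= ij.
  - congr (_, _); apply: rot_eq ij; rewrite ?rev_uniq ?size_rev //.
    exact/eqP.
  - by case: (no_mirror j i); rewrite /= ij.
  - by case: (no_mirror i j).
  - by congr (_, _); apply: rot_eq ij => //; apply/eqP.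
rewrite -[k in RHS]card_ord -card_bool -card_prod -(card_imset _ f_inj).
apply: eq_card => s; rewrite !inE; apply/existsP/imsetP => [[i]|[[b i] _ ->]].
  case/orP=> /eqP st; [exists (false, i)|exists (true, i)] => //;
  exact: val_inj.
by exists i; case: b; rewrite /f /= eqxx ?orbT.
Qed.

(** The classes are the orbits of the dihedral group of order 2k, hence they
    partition the closed paths into blocks of that size. *)
Lemma card_ucycles : #|D| = cycle_count e k * (2 * k).
Proof.
rewrite /cycle_count /cycles k_ge3 /=.
have -> : [set cycle_class t | t : k.-tuple T & ucycleb e t]
    = @cycle_class T k @: D.
  by apply/setP=> C; apply/imsetP/imsetP=> -[t]; rewrite ?inE => tD ->;
    exists t; rewrite ?inE.
apply: card_uniform_partition => [C /imsetP[t tD ->{C}]|].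
  by move: tD; rewrite inE => /andP[_]; apply: card_cycle_class.
apply/and3P; split.
- apply/eqP/setP=> t; apply/bigcupP/idP => [[C /imsetP[s sD ->{C}]]|tD].
    by apply/subsetP/cycle_class_sub.
  by exists (cycle_class t); rewrite ?cycle_class_refl ?imset_f.
- apply/trivIsetP=> C C' /imsetP[s sD ->{C}] /imsetP[t tD ->{C'}].
  apply: contraR => /pred0Pn[u /andP[/= us ut]]; apply/eqP/setP=> w.
  apply/idP/idP=> ws;
    [apply: cycle_class_trans ut _ | apply: cycle_class_trans us _];
    exact: cycle_class_trans (cycle_class_sym _) ws.
apply/imsetP=> -[t _ /esym/setP/(_ t)].
by rewrite cycle_class_refl inE.
Qed.
End CycleClasses.

Section CycleCount.
Variables (G : sgraph) (vs : seq G) (nb : G -> seq G).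
Hypothesis vs_uniq : uniq vs.
Hypothesis vsG : vs =i G.
Hypothesis nb_uniq : forall v, uniq (nb v).
Hypothesis nbG : forall u v, (v \in nb u) = adjacent u v.

Definition path_ext (s : seq G) : seq G :=
  if s is y :: _ then [seq x <- nb y | x \notin s] else vs.

Definition closes (s : seq G) : bool :=
  if s is x :: s' then x \in nb (last x s') else false.

Definition ucycle_count k : nat := count closes (grow path_ext k).

Lemma admissible_path x s :
  admissible path_ext (x :: s) = uniq (x :: s) && path (@adjacent G) x s.
Proof.
elim: s x => [|y s IHs] x; first by rewrite /= vsG.
rewrite -[LHS]/((x \in path_ext (y :: s)) && admissible path_ext (y :: s)).
rewrite IHs mem_filter nbG adjacent_sym /=.
by case: (x \notin _); case: (adjacent x y); rewrite ?andbF ?andbT.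
Qed.

Lemma ucycle_countE k :
  0 < k -> #|[set t : k.-tuple G | ucycleb (@adjacent G) t]| = ucycle_count k.
Proof.
move=> k_gt0; rewrite /ucycle_count -size_filter cardE -(size_map val).
apply/perm_size/uniq_perm.
- by rewrite (map_inj_uniq val_inj) enum_uniq.
- apply/filter_uniq/grow_uniq => -[|y s] //; exact: filter_uniq.
move=> s; rewrite mem_filter mem_grow; apply/mapP/and3P=> [[t]|[]].
  rewrite mem_enum inE => /andP[ct ut] ->; rewrite size_tuple eqxx.
  case: t ct ut => -[|x s'] sz_t ct ut.
    by move: k_gt0; rewrite -{1}(eqP sz_t).
  rewrite admissible_path ut /=; rewrite /= rcons_path in ct.
  by have /andP[-> e_last] := ct; rewrite nbG.
case: s => // x s; rewrite /closes nbG => e_last sz_s.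
rewrite admissible_path => /andP[us ps].
exists (Tuple sz_s) => //; rewrite mem_enum inE /ucycleb us andbT /= rcons_path.
by rewrite ps.
Qed.

Lemma cycle_count_small k : k < 3 -> cycle_count (@adjacent G) k = 0.
Proof.
rewrite ltnNge => /negPf k_lt3; apply/eqP; rewrite cards_eq0 -subset0.
by apply/subsetP=> C /imsetP[t]; rewrite inE k_lt3.
Qed.

Lemma cycle_countE k :
  2 < k -> cycle_count (@adjacent G) k * (2 * k) = ucycle_count k.
Proof.
move=> k_ge3; rewrite -ucycle_countE ?(leq_trans _ k_ge3) //.
by rewrite card_ucycles //; apply: adjacent_sym.
Qed.
End CycleCount.

(** * Automorphisms *)

Section Rigidity.
Variables (G : sgraph) (vs : seq G) (nb : G -> seq G).
Hypothesis vs_uniq : uniq vs.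
Hypothesis vsG : vs =i G.
Hypothesis nbG : forall u v, (v \in nb u) = adjacent u v.

(** The possible images of a list of vertices under a map that is injective and
    preserves adjacency and non-adjacency.  Extending the images vertex by
    vertex discards the wrong ones early. *)
Fixpoint adjacency_copies (ws : seq G) : seq (seq G) :=
  if ws is w :: ws' then
    [seq x :: s | s <- adjacency_copies ws',
       x <- [seq x <- vs | (x \notin s) &&
              all (fun p => (p.1 \in nb w) == (p.2 \in nb x)) (zip ws' s)]]
  else [:: [::]].

Lemma automorphism_copy p ws :
  p \in automorphisms G -> uniq ws -> map p ws \in adjacency_copies ws.
Proof.
rewrite inE => /forallP autp; elim: ws => //= w ws IHws /andP[wNws uws].
apply/allpairsPdep; exists (map p ws), (p w); split=> //; first exact: IHws.
rewrite mem_filter vsG (mem_map perm_inj) wNws andbT /=.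
apply/allP=> q /(nthP (w, w))[i]; rewrite size_zip size_map minnn => i_ws <-{q}.
rewrite nth_zip ?size_map //= (nth_map w) // !nbG.
by rewrite eq_sym; have /forallP := autp w; apply.
Qed.

Lemma rigid_by_copies :
  adjacency_copies vs = [:: vs] -> #|automorphisms G| = 1.
Proof.
move=> emb; rewrite (_ : automorphisms G = [set 1%g]) ?cards1 //.
apply/setP=> p; rewrite in_set1; apply/idP/eqP=> [autp|->].
  have:= automorphism_copy autp vs_uniq; rewrite emb inE => /eqP p_vs.
  apply/permP=> v; rewrite perm1.
  have /(nthP v)[i i_vs <-] : v \in vs by rewrite vsG.
  by rewrite -(nth_map v v p) // p_vs.
by rewrite inE; apply/forallP=> u; apply/forallP=> v; rewrite !perm1.
Qed.
End Rigidity.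

(** * Spanning trees *)

Section AddedEdge.
Variable T : finType.
Implicit Types (e : rel T) (u v x y : T) (p : seq T).

Lemma acyclicP e :
  reflect (forall p, 2 < size p -> ~~ ucycleb e p) (acyclic e).
Proof.
apply: (iffP forallP) => [acy p p_gt2 | acy k].
  apply/negP=> ucp; have /andP[_ up] := ucp.
  have p_small : size p < #|T|.+1.
    by rewrite ltnS -(card_uniqP up) max_card.
  have := acy (Ordinal p_small); rewrite cards_eq0 => /eqP/setP.
  move/(_ (cycle_class (in_tuple p))).
  by rewrite in_set0 imset_f // inE /= p_gt2.
rewrite cards_eq0; apply/eqP/setP=> C; rewrite [RHS]inE.
apply/imsetP=> -[t]; rewrite inE => /andP[k_gt2 ut] _.
by have := acy t; rewrite size_tuple ut => /(_ k_gt2).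
Qed.

Lemma acyclic_sub e e' : subrel e e' -> acyclic e' -> acyclic e.
Proof.
move=> ee' /acyclicP acy; apply/acyclicP=> p /acy; apply: contra.
by case/andP=> cp up; rewrite /ucycleb up andbT (sub_cycle ee').
Qed.

Definition add_edge e u v : rel T :=
  [rel x y | [|| e x y, (x == u) && (y == v) | (x == v) && (y == u)]].

Lemma sub_add_edge e u v : subrel e (add_edge e u v).
Proof. by move=> x y exy; rewrite /add_edge /= exy. Qed.

Lemma path_avoiding e x y p :
  x \notin y :: p -> path (fun a b => (a == x) || e a b) y (rcons p x) ->
  path e y (rcons p x).
Proof.
elim: p y => [|z p IHp] y; rewrite in_cons negb_or => /andP[xy xp] /=;
  rewrite (eq_sym y) (negPf xy) //=.
by move=> /andP[-> /(IHp z xp)].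
Qed.

(** A cycle through the new edge is that edge together with a path between its
    ends in the old graph, and conversely. *)
Lemma acyclic_add_edge e u v :
  symmetric e -> u != v -> ~~ e u v ->
  acyclic (add_edge e u v) = acyclic e && ~~ connect e u v.
Proof.
move=> e_sym uv euv; apply/idP/andP=> [acy|[/acyclicP acy not_uv]].
  split; first exact: acyclic_sub (@sub_add_edge e u v) acy.
  apply: contraL acy => /connectP[p0 /shortenP[p ep up _] def_v] {p0}.
  apply/acyclicP=> /(_ (u :: p)) nocycle; move: ep up def_v uv euv nocycle.
  case: p => [|y [|z p]]; first by move=> _ _ /= ->; rewrite eqxx.
    by move=> /= /andP[euy _] _ ->; rewrite euy.
  move=> ep up def_v _ _ /(_ isT)/negP[]; rewrite /ucycleb up andbT.
  rewrite -[path.cycle _ _]/(path _ u (rcons [:: y, z & p] u)) rcons_path.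
  by rewrite (sub_path (@sub_add_edge e u v) ep) -def_v /add_edge /= !eqxx !orbT.
apply/acyclicP=> p p_gt2; apply: contra not_uv => /andP[cp up].
have [/allP bad|/allPn[x px]] := boolP (all (fun x => e x (next p x)) p).
  case/negP: (acy p p_gt2); rewrite /ucycleb up andbT.
  exact: cycle_from_next.
(* The cycle is turned so that it starts with the new edge, from x to y. *)
have [i q def_q] := rot_to px; rewrite -(next_rot i up) def_q => bad_x.
rewrite -(rot_cycle i) def_q in cp; rewrite -(rot_uniq i) def_q in up.
rewrite -(size_rot i) def_q in p_gt2; clear acy def_q p px i.
case: q => [|y [|z q]] // in cp up p_gt2 bad_x *.
have xNq : x \notin y :: z :: q by case/andP: up.
have nxt_x : next [:: x, y, z & q] x = y by rewrite /= eqxx.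
rewrite nxt_x in bad_x.
have xy : (x == u) && (y == v) || (x == v) && (y == u).
  by move: cp => /= /andP[]; rewrite {1}/add_edge /= (negPf bad_x).
suffices e_yx : connect e y x.
  case/orP: xy => /andP[/eqP xu /eqP yv]; subst x y => //.
  by rewrite (sym_connect_sym e_sym).
apply/connectP; exists (rcons (z :: q) x); last by rewrite last_rcons.
apply: path_avoiding => //.
suffices: path.cycle (fun a b => (a == x) || e a b) [:: x, y, z & q].
  by rewrite /= => /andP[_].
(* Past x, no step can use the new edge again: it would have to lead from y
   back to x, but the successor of y is z. *)
apply: cycle_from_next => // w pw.
have [->|wx] := eqVneq w x; first by [].
have [x_y x_z] : x != y /\ x != z.
  by move: xNq; rewrite !inE !negb_or => /and3P[].
have nxt_y : next [:: x, y, z & q] y = z.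
  by rewrite /= (eq_sym y) (negPf x_y) eqxx.
have := next_cycle cp pw; set nw := next _ w.
rewrite {1}/add_edge /= => /orP[//|w_bad].
have w_y : w = y.
  case/orP: xy w_bad => /andP[/eqP<- /eqP<-];
    by rewrite (negPf wx) /= ?orbF => /andP[/eqP].
rewrite /nw in w_bad *; rewrite w_y nxt_y in w_bad.
by case/orP: xy w_bad => /andP[/eqP<- /eqP<-];
  rewrite (eq_sym y x) (eq_sym z x) (negPf x_y) (negPf x_z) ?andbF.
Qed.

Definition contract u v x := if x == u then v else x.

(** Components are recorded by labels, so that adding an edge between two of
    them becomes a substitution. *)
Definition labels e (lab : T -> T) :=
  forall x y, connect e x y = (lab x == lab y).

Lemma labels_add_edge e u v lab :
  symmetric e -> labels e lab ->
  labels (add_edge e u v) (contract (lab u) (lab v) \o lab).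
Proof.
move=> e_sym e_lab x y.
have add_sym : symmetric (add_edge e u v).
  move=> a b; rewrite /add_edge /= e_sym (andbC (a == u)) (andbC (a == v)).
  by congr (_ || _); exact: orbC.
have e_add a b : lab a = lab b -> connect (add_edge e u v) a b.
  move/eqP; rewrite -e_lab; apply: connect_sub => {}a {}b ab.
  exact/connect1/sub_add_edge.
have uv : connect (add_edge e u v) u v.
  by apply: connect1; rewrite /add_edge /= !eqxx orbT.
have vu : connect (add_edge e u v) v u by rewrite (sym_connect_sym add_sym).
apply/idP/eqP=> [/connectP[p] | ].
  elim: p x => [|z p IHp] x /= => [_ ->|/andP[xz zp] def_y] //.
  have /= <- := IHp z zp def_y; case/orP: xz => [xz|].
    have /eqP-> // : lab x == lab z by rewrite -e_lab connect1.
  by case/orP=> /andP[/eqP-> /eqP->]; rewrite /contract eqxx; case: eqP.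
rewrite /= /contract; case: eqP => [xu|_]; case: eqP => [yu|_] xy.
- by apply: e_add; rewrite xu yu.
- exact: connect_trans (e_add _ _ xu) (connect_trans uv (e_add _ _ xy)).
- apply: connect_trans (e_add _ _ xy) (connect_trans vu _).
  by apply: e_add; rewrite yu.
exact: e_add.
Qed.

Lemma card_contract (lab : T -> T) (x y : T) :
  lab x != lab y ->
  #|[set contract (lab x) (lab y) (lab z) | z : T]|.+1 = #|[set lab z | z : T]|.
Proof.
move=> xy; rewrite [RHS](cardsD1 (lab x)) imset_f // add1n; congr _.+1.
apply: eq_card => a; rewrite in_setD1.
apply/imsetP/andP=> [[z _ ->]|[ax /imsetP[z _ az]]].
  rewrite /contract; case: (lab z =P lab x) => [_|/eqP zx]; split;
    rewrite ?imset_f //.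
  by rewrite eq_sym.
by exists z; rewrite // /contract -az (negPf ax).
Qed.
End AddedEdge.

Section TreeCount.
Variable G : sgraph.
Implicit Types (F A : {set {set G}}) (es : seq (G * G)).

Lemma edge_subset_rel_sym F : symmetric (edge_subset_rel F).
Proof. by move=> u v; rewrite /edge_subset_rel /= setUC. Qed.

Lemma edge_subset_relU1 F u v :
  edge_subset_rel ([set u; v] |: F) =2 add_edge (edge_subset_rel F) u v.
Proof.
move=> x y; rewrite /edge_subset_rel /add_edge /= in_setU1 eq_set2 orbC.
by [].
Qed.

(** F collects the edges that have been chosen and A those that are still to be
    decided. *)
Definition tree_count F A : nat :=
  #|[set F' : {set {set G}} |
      [&& F \subset F', F' \subset F :|: A & is_tree (edge_subset_rel F')]]|.

Lemma spanning_tree_countE : spanning_tree_count G = tree_count set0 (edges G).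
Proof. by apply: eq_card => F; rewrite !inE sub0set set0U. Qed.

(** The trees without a and those with a: deletion and contraction of a. *)
Lemma tree_countU1 F A a :
  a \notin F -> a \notin A ->
  tree_count F (a |: A) = tree_count F A + tree_count (a |: F) A.
Proof.
move=> aF aA; rewrite /tree_count.
rewrite -(cardsID [set F' : {set {set G}} | a \notin F']).
congr (_ + _); apply: eq_card => F'; rewrite !inE ?negbK.
  rewrite setUCA; case aF': (a \in F').
    rewrite andbF; apply/esym/and3P=> -[_ /subsetP/(_ a aF')].
    by rewrite inE (negPf aF) (negPf aA).
  rewrite andbT; congr [&& _, _ & _]; apply/idP/idP=> [sF'|sF'].
    apply/subsetP=> b bF'; have:= subsetP sF' b bF'; rewrite in_setU1.
    by case: eqP => // ba; rewrite -ba bF' in aF'.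
  exact: subset_trans sF' (subsetUr _ _).
by rewrite subUset sub1set setUCA -setUA; case: (a \in F'); rewrite ?andbF.
Qed.

Lemma tree_count_cyclic F A :
  ~~ acyclic (edge_subset_rel F) -> tree_count F A = 0.
Proof.
move=> cyF; apply/eqP; rewrite cards_eq0 -subset0; apply/subsetP=> F'.
rewrite inE => /and3P[/subsetP sFF' _ /andP[_ acF']]; case/negP: cyF.
by apply: acyclic_sub acF' => x y; apply: sFF'.
Qed.

Lemma tree_count_leaf F :
  acyclic (edge_subset_rel F) ->
  tree_count F set0 = connected (edge_subset_rel F).
Proof.
move=> acF; rewrite /tree_count setU0.
case conF: (connected _); last first.
  apply/eqP; rewrite cards_eq0 -subset0; apply/subsetP=> F'.
  rewrite inE => /and3P[sFF' sF'F /andP[]].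
  have -> : F' = F by apply/eqP; rewrite eqEsubset sF'F.
  by rewrite conF.
rewrite -[RHS](cards1 F); apply: eq_card => F'; rewrite !inE andbA -eqEsubset.
by rewrite eq_sym; case: eqP => // ->; rewrite /is_tree conF acF.
Qed.

(** Choices of k edges of es, taken in order, each of which joins two different
    components when it is taken; lab labels the current components. *)
Fixpoint forests k (lab : G -> G) es : nat :=
  if es is (u, v) :: es' then
    forests k lab es' +
    (if (lab u == lab v) || (k == 0) then 0
     else forests k.-1 (contract (lab u) (lab v) \o lab) es')
  else k == 0.

Fixpoint edge_set es : {set {set G}} :=
  if es is (u, v) :: es' then [set u; v] |: edge_set es' else set0.

Fixpoint simple_edges es : bool :=
  if es is (u, v) :: es' then
    [&& u != v, (u, v) \notin es', (v, u) \notin es' & simple_edges es']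
  else true.

Lemma mem_edge_set es x y :
  ([set x; y] \in edge_set es) = ((x, y) \in es) || ((y, x) \in es).
Proof.
elim: es => [|[u v] es IHes] /=; first by rewrite inE.
rewrite in_setU1 eq_set2 IHes !in_cons !xpair_eqE (andbC (y == u)).
by rewrite -!orbA; congr (_ || _); rewrite orbCA.
Qed.

Lemma edge_set_pairs es a : a \in edge_set es -> exists u v, a = [set u; v].
Proof.
elim: es => [|[u v] es IHes] /=; first by rewrite inE.
by rewrite in_setU1 => /orP[/eqP->|/IHes //]; exists u, v.
Qed.

(** An edge inside a component would close a cycle, and an edge between two
    components merges them.  The acyclic set F becomes a spanning tree after
    exactly as many merges as it has components in excess of one. *)
Lemma tree_count_forests F lab es :
  0 < #|G| -> acyclic (edge_subset_rel F) -> labels (edge_subset_rel F) lab ->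
  simple_edges es -> [disjoint F & edge_set es] ->
  tree_count F (edge_set es) = forests #|[set lab z | z : G]|.-1 lab es.
Proof.
move=> /card_gt0P[z0 _]; elim: es F lab => [|[u v] es IHes] F lab acF labF /=.
  move=> _ _; rewrite tree_count_leaf // /connected.
  have -> : 0 < #|G| by apply/card_gt0P; exists z0.
  congr nat_of_bool; rewrite /= -(eqn_add2r 1) !addn1 prednK.
    apply/forallP/cards1P=> [conF|[a def_a] x]; last first.
      apply/forallP=> y; rewrite labF.
      have: lab x \in [set lab z | z : G] by rewrite imset_f.
      have: lab y \in [set lab z | z : G] by rewrite imset_f.
      by rewrite def_a !inE => /eqP-> /eqP->.
    exists (lab z0); apply/setP=> a; rewrite inE.
    apply/imsetP/eqP=> [[z _ ->]|->]; last by exists z0.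
    by apply/eqP; rewrite -labF; have /forallP := conF z; apply.
  by apply/card_gt0P; exists (lab z0); rewrite imset_f.
case/and4P=> uv uvNes vuNes es_simple disF.
have aF : [set u; v] \notin F.
  by rewrite (disjointFl disF) // in_setU1 eqxx.
have aes : [set u; v] \notin edge_set es by rewrite mem_edge_set negb_or uvNes.
have disF' : [disjoint F & edge_set es].
  by apply: disjointWr disF; apply: subsetUr.
rewrite tree_countU1 // (IHes F lab) //; congr (_ + _).
have eqU := edge_subset_relU1 F u v.
have symF := @edge_subset_rel_sym F.
have acU : acyclic (edge_subset_rel ([set u; v] |: F)) = (lab u != lab v).
  rewrite -labF -[RHS]andTb -acF -acyclic_add_edge //.
  by apply/idP/idP; apply: acyclic_sub => x y; rewrite eqU.
case: eqP => [luv|/eqP luv] /=.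
  by rewrite tree_count_cyclic // acU luv eqxx.
rewrite -(card_contract luv) /=; case: eqP => [k0|_].
  have: 0 < 0; last by [].
  rewrite -{2}k0; apply/card_gt0P; exists (contract (lab u) (lab v) (lab z0)).
  by apply/imsetP; exists z0.
rewrite (IHes _ (contract (lab u) (lab v) \o lab)) ?acU //.
  by move=> x y; rewrite (eq_connect eqU); apply: labels_add_edge.
by move: disF'; rewrite !disjoints_subset subUset sub1set in_setC aes.
Qed.

(** Substituting in the list of edges instead of in the labelling forgets the
    vertices without remaining edges, so that many partial choices lead to the
    same list. *)
Lemma forests_relabel k (f lab : G -> G) es :
  forests k (f \o lab) es = forests k f [seq (lab p.1, lab p.2) | p <- es].
Proof.
elim: es k f => [|[u v] es IHes] k f //=; rewrite IHes; congr (_ + _).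
by case: ifP => // _; rewrite -IHes.
Qed.
End TreeCount.

(** The head is the least significant digit: lists are told apart at the first
    item in which they differ. *)
Definition digits (T : Type) (code : T -> N) (s : seq T) : N :=
  foldr (fun x h => N.add (code x) (N.mul 16%num h)) N0 s.

Section TreeEvaluation.
Variables (G : sgraph) (code : G -> N).
Implicit Types (es : seq (G * G)) (m : N) (k : nat).

(** A state consists of a fingerprint of its list of edges, the number of edges
    to be chosen, and that list.  Fingerprints speed up the comparison of
    states. *)
Definition state : Type := N * (nat * seq (G * G)).

Definition fingerprint es : N :=
  digits code (flatten [seq [:: p.1; p.2] | p <- es]).

Definition weight (s : state) : nat := forests s.2.1 id s.2.2.

Definition total (l : seq (N * state)) : nat :=
  sumn [seq N.to_nat p.1 * weight p.2 | p : N * state <- l].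

(** Equal states are merged and their multiplicities added.  The inner
    conditional is a conjunction that never evaluates its second member in
    vain, unlike && under call-by-value evaluation. *)
Fixpoint insert m (s : state) (l : seq (N * state)) : seq (N * state) :=
  if l is (m', s') :: l' then
    if (if N.eqb s.1 s'.1 then s == s' else false) then (N.add m m', s') :: l'
    else (m', s') :: insert m s l'
  else [:: (m, s)].

Definition collect (l : seq (N * state)) : seq (N * state) :=
  foldr (fun p => insert p.1 p.2) [::] l.

Lemma total_collect l : total (collect l) = total l.
Proof.
have total_insert m s l' :
    total (insert m s l') = N.to_nat m * weight s + total l'.
  elim: l' => [|[m' s'] l' IHl] //=; case: ifP => [|_] /=.
    case: ifP => // _ /eqP->.
    by rewrite /total /= N2Nat.inj_add plusE mulnDl addnA.
  by rewrite /total /= -/(total _) IHl addnCA.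
by elim: l => //= [[m s] l IHl]; rewrite total_insert IHl.
Qed.

(** States that require more edges than remain contribute nothing. *)
Definition entry m k es : seq (N * state) :=
  if k <= size es then [:: (m, (fingerprint es, (k, es)))] else [::].

Definition branch (p : N * state) : seq (N * state) :=
  let: (m, (_, (k, es))) := p in
  if es is (u, v) :: es' then
    entry m k es' ++
    (if (u == v) || (k == 0) then [::]
     else entry m k.-1 [seq (contract u v q.1, contract u v q.2) | q <- es'])
  else [:: p].

Lemma forests_short k lab es : size es < k -> @forests G k lab es = 0.
Proof.
elim: es k lab => [|[u v] es IHes] [|k] lab //= es_k.
rewrite IHes ?(ltnW es_k) //; case: ifP => // _.
by rewrite IHes.
Qed.

Lemma total_cat l l' : total (l ++ l') = total l + total l'.
Proof. by rewrite /total map_cat sumn_cat. Qed.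

Lemma total_entry m k es : total (entry m k es) = N.to_nat m * forests k id es.
Proof.
rewrite /entry; case: leqP => [_|es_k]; first by rewrite /total /= addn0.
by rewrite forests_short // muln0.
Qed.

Lemma total_branch p : total (branch p) = N.to_nat p.1 * weight p.2.
Proof.
case: p => m [fp [k [|[u v] es]]] /=; first by rewrite /total /= addn0.
rewrite total_cat total_entry /weight /= mulnDr; congr (_ + _).
case: ifP => _; first by rewrite muln0.
by rewrite total_entry -forests_relabel.
Qed.

Lemma total_branches l : total (flatten (map branch l)) = total l.
Proof.
by elim: l => //= p l IHl; rewrite total_cat total_branch IHl.
Qed.

Definition evaluate_forests k es : seq (N * state) :=
  iter (size es) (fun l => collect (flatten (map branch l))) (entry 1%num k es).

Lemma evaluate_forestsE k es m fp :
  evaluate_forests k es = [:: (m, (fp, (0, [::])))] ->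
  forests k id es = N.to_nat m.
Proof.
move=> res; have : total (evaluate_forests k es) = forests k id es.
  rewrite /evaluate_forests; elim: (size es) => [|n IHn] /=.
    by rewrite total_entry mul1n.
  by rewrite total_collect total_branches.
by rewrite res /total /= addn0 /weight /= muln1.
Qed.
End TreeEvaluation.

Section SpanningTrees.
Variables (G : sgraph) (vs : seq G) (nb : G -> seq G) (code : G -> N).
Hypothesis vs_uniq : uniq vs.
Hypothesis vsG : vs =i G.
Hypothesis nb_uniq : forall v, uniq (nb v).
Hypothesis nbG : forall u v, (v \in nb u) = adjacent u v.

Lemma edge_set_half_edges : edge_set (half_edges vs nb) = edges G.
Proof.
have mem u v : ([set u; v] \in edge_set (half_edges vs nb)) = adjacent u v.
  by rewrite mem_edge_set -half_edges_orient.
apply/setP=> a; apply/idP/idP=> [a_e|/imsetP[[u v]]].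
  have [u [v def_a]] := edge_set_pairs a_e.
  by move: a_e; rewrite def_a mem mem_edges.
by rewrite inE /= => uv ->; rewrite mem.
Qed.

Lemma half_edges_simple : simple_edges (half_edges vs nb).
Proof.
have: uniq (half_edges vs nb).
  apply/filter_uniq/allpairs_uniq_dep => // [[u v] [u' v']] _ _ /= [-> ->].
  by [].
have: all (fun p => index p.1 vs < index p.2 vs) (half_edges vs nb).
  exact: filter_all.
elim: (half_edges vs nb) => //= [[u v] es IHes] /= /andP[uv oes] /andP[-> ues].
rewrite IHes // andbT; apply/andP; split.
  by apply: contraL uv => /eqP->; rewrite ltnn.
by apply/negP=> /(allP oes) /=; rewrite ltnNge (ltnW uv).
Qed.

Lemma spanning_tree_count_evaluated m fp :
  0 < #|G| ->
  evaluate_forests code #|G|.-1 (half_edges vs nb)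
    = [:: (m, (fp, (0, [::])))] ->
  spanning_tree_count G = N.to_nat m.
Proof.
move=> G_gt0 /evaluate_forestsE <-.
rewrite spanning_tree_countE -edge_set_half_edges.
have no_edge x y : edge_subset_rel (@set0 {set G}) x y = false.
  by rewrite /edge_subset_rel /= inE.
rewrite (tree_count_forests (lab := id)) ?half_edges_simple //.
- have -> : [set id z | z : G] = [set: G]; last by rewrite cardsT.
  by apply/setP=> z; rewrite in_setT; apply/imsetP; exists z.
- apply/acyclicP=> -[|x [|y p]] // _; apply/negP=> /andP[] /=.
  by rewrite no_edge.
- by move=> x y; apply: connect_isolated => z; rewrite no_edge.
by rewrite disjoints_subset sub0set.
Qed.
End SpanningTrees.

(** * Faces of rotation systems *)

Lemma porbit_fcycle (T : finType) (s : {perm T}) (c : seq T) (x : T) :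
  fcycle s c -> x \in c -> porbit s x = [set y in c].
Proof.
move=> sc xc; apply/setP=> y; rewrite inE -(fconnect_cycle sc xc).
apply/porbitP/idP=> [[i ->]|xy]; first by rewrite permX fconnect_iter.
by exists (findex s x y); rewrite permX iter_findex.
Qed.

Section FaceTracing.
Variables (D : finType) (phi : {perm D}) (ds : seq D).
Hypothesis ds_uniq : uniq ds.

(** What is known of a permutation of ds of which only some values have been
    revealed: the number of its complete cycles, and the two ends of each of
    the other maximal segments x, phi x, phi (phi x), ... *)
Definition trace : Type := nat * seq (D * D).

(** The effect of revealing that x is mapped to y.  The segment that ends at x
    continues with the one that starts at y; if both are the same segment, a
    cycle is completed.  Segments keep their places in the list, so that traces
    reached in different ways are equal as lists. *)
Definition link (x y : D) (st : trace) : trace :=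
  let: (c, ch) := st in
  if (y \in unzip1 ch) && (x \in unzip2 ch) then
    (c + ((y, x) \in ch),
     [seq (p.1, if p.2 == x then (nth (y, y) ch (index y (unzip1 ch))).2
                else p.2) | p <- ch & p.1 != y])
  else st.

Definition ends (P : D * seq D) : D * D := (P.1, last P.1 P.2).
Definition items (P : D * seq D) : seq D := P.1 :: P.2.

(** Cs are the complete cycles and Ps the other segments, each given by its head
    and its tail. *)
Definition traced (st : trace) : Prop :=
  exists Cs Ps,
    [/\ size Cs = st.1, all (fun C => (C != [::]) && fcycle phi C) Cs,
        all (fun P => path (frel phi) P.1 P.2) Ps, perm_eq st.2 (map ends Ps)
      & perm_eq (flatten Cs ++ flatten (map items Ps)) ds].

Definition untraced : trace := (0, [seq (d, d) | d <- ds]).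

Lemma traced_untraced : traced untraced.
Proof.
exists [::], [seq (d, [::]) | d <- ds]; split=> //=.
- by apply/allP=> _ /mapP[d _ ->].
- by rewrite -map_comp.
by rewrite -map_comp (flatten_map1 id) map_id.
Qed.

Lemma uniq_endpoints (f : D * seq D -> D) Ps :
  (forall P, f P \in items P) -> uniq (flatten (map items Ps)) ->
  uniq (map f Ps).
Proof.
move=> f_items; elim: Ps => // P Ps IHPs.
rewrite -[flatten _]/(items P ++ flatten (map items Ps)).
rewrite cat_uniq => /and3P[_ disP /IHPs uPs]; rewrite /= uPs andbT.
apply: contra disP => /mapP[Q PsQ fPQ]; apply/hasP; exists (f P); last first.
  exact: f_items.
by apply/flatten_mapP; exists Q; rewrite // fPQ f_items.
Qed.

(** As ds has no repetition, at most one segment starts at y and at most one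
    ends at x; they are Py and Px below, and the proof rearranges the segments
    so that these two come first. *)
Lemma traced_link x y st : phi x = y -> traced st -> traced (link x y st).
Proof.
move=> xy; case: st => c ch [Cs [Ps [/= sz_Cs fCs pPs chPs dsPs]]].
rewrite /link; case: ifP => [/andP[y1 x2]|_]; last by exists Cs, Ps.
have [Py PsPy def_y] : exists2 P, P \in Ps & P.1 = y.
  move: y1; rewrite (perm_mem (perm_map fst chPs)) -map_comp => /mapP[P PsP ->].
  by exists P.
have [R PsR] : exists R, perm_eq Ps (Py :: R).
  by exists (rem Py Ps); apply: perm_to_rem.
rewrite (perm_all _ PsR) /= in pPs; have /andP[pPy pR] := pPs.
have {}chPs : perm_eq ch (map ends (Py :: R)).
  by apply: perm_trans chPs _; apply: perm_map.
have {}dsPs : perm_eq (flatten Cs ++ flatten (map items (Py :: R))) ds.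
  apply: perm_trans dsPs; rewrite perm_cat2l.
  apply: perm_flatten; apply: perm_map.
  by rewrite perm_sym.
have uR : uniq (flatten (map items (Py :: R))).
  by move: ds_uniq; rewrite -(perm_uniq dsPs) cat_uniq => /and3P[].
have y_heads : {in R, forall P, P.1 != y}.
  have /= /andP[y_notin _] :=
    uniq_endpoints (f := fst) (fun P => mem_head _ _) uR.
  move=> P RP; apply: contraNneq y_notin => P_y.
  by rewrite def_y -P_y map_f.
have last_uniq : uniq (map (fun P => last P.1 P.2) (Py :: R)).
  by apply: uniq_endpoints uR => P; apply: mem_last.
have end_y : (nth (y, y) ch (index y (unzip1 ch))).2 = last y Py.2.
  set q := nth _ _ _; have i_ch : index y (unzip1 ch) < size ch.
    by rewrite -(size_map fst) index_mem.
  have q_y : q.1 = y by rewrite -(nth_map _ y) // nth_index.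
  have : q \in map ends (Py :: R) by rewrite -(perm_mem chPs) mem_nth.
  case/mapP=> P; rewrite inE => /orP[/eqP->|RP] def_q.
    by rewrite def_q -def_y.
  by have := y_heads P RP; rewrite -q_y def_q eqxx.
set g := fun p : D * D => (p.1, if p.2 == x then _ else p.2).
have ch_g : perm_eq [seq g p | p <- ch & p.1 != y] (map g (map ends R)).
  rewrite (permPl (perm_map _ (perm_filter _ chPs))) /= def_y eqxx /=.
  rewrite (all_filterP _) //.
  by apply/allP=> _ /mapP[P RP ->]; apply: y_heads.
(* Either the segment from y already ends at x, and a cycle closes, or the
   segment that ends at x is another one, and the two are concatenated. *)
have [last_Py|last_Py] := eqVneq (last y Py.2) x.
  have yx_ch : (y, x) \in ch.
    by rewrite (perm_mem chPs) inE /ends def_y last_Py eqxx.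
  exists (items Py :: Cs), R; split => //=.
  - by rewrite yx_ch addn1 sz_Cs.
  - rewrite fCs andbT rcons_path pPy /= def_y last_Py xy eqxx //.
  - rewrite (permPl ch_g) -map_comp.
    have/eq_in_map-> // : {in R, g \o ends =1 ends}; move=> P RP.
    rewrite /g /=; case: eqP => // last_P.
    move: last_uniq => /= /andP[/negP[]]; rewrite def_y last_Py -last_P.
    by apply/mapP; exists P.
  apply: perm_trans dsPs; pose F := flatten (map items R).
  rewrite -[X in perm_eq X _]/((items Py ++ flatten Cs) ++ F).
  rewrite -[X in perm_eq _ X]/(flatten Cs ++ (items Py ++ F)).
  by rewrite catA perm_cat2r perm_catC.
have [Px RPx def_x] : exists2 P, P \in R & last P.1 P.2 = x.
  move: x2; rewrite (perm_mem (perm_map snd chPs)) -map_comp => /mapP[P].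
  rewrite inE => /orP[/eqP->|RP] def_x; last by exists P.
  by rewrite def_x /= def_y eqxx in last_Py.
have [R' RR'] : exists R', perm_eq R (Px :: R').
  by exists (rem Px R); apply: perm_to_rem.
rewrite (perm_all _ RR') /= in pR; have /andP[pPx pR'] := pR.
have yx_ch : (y, x) \notin ch.
  rewrite (perm_mem chPs); apply/mapP=> -[P]; rewrite inE => /orP[/eqP->|RP] [].
    by rewrite -{1}def_y => _ xP; rewrite xP def_y eqxx in last_Py.
  by move=> yP; have := y_heads P RP; rewrite yP eqxx.
exists Cs, ((Px.1, Px.2 ++ items Py) :: R'); split=> //=.
- by rewrite (negPf yx_ch) addn0.
- by rewrite cat_path /= pPx pPy def_x def_y xy eqxx.
- rewrite (permPl ch_g) (permPl (perm_map _ (perm_map _ RR'))) /= -map_comp.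
  rewrite /g /= def_x eqxx end_y /ends /= last_cat /= def_y.
  set rhs := map _ R'; suffices -> : rhs = map ends R' by [].
  apply/eq_in_map => P R'P /=; rewrite /ends /=; case: eqP => // last_P.
  move: last_uniq => /= /andP[_]; rewrite (perm_uniq (perm_map _ RR')) /=.
  by case/andP=> /mapP[]; exists P; rewrite // def_x.
apply: perm_trans dsPs; rewrite perm_cat2l.
pose F := flatten (map items R').
have F_R : perm_eq (items Px ++ F) (flatten (map items R)).
  by rewrite perm_sym; apply: perm_trans (perm_flatten (perm_map items RR')) _.
rewrite -[X in perm_eq _ X]/(items Py ++ flatten (map items R)).
rewrite -[X in perm_eq X _]/((items Px ++ items Py) ++ F).
apply: perm_trans (_ : perm_eq _ ((items Py ++ items Px) ++ F)) _.
  by rewrite perm_cat2r perm_catC.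
by rewrite -catA perm_cat2l.
Qed.

Lemma traced_card c :
  traced (c, [::]) -> #|[set porbit phi d | d in ds]| = c.
Proof.
case=> Cs [[|P Ps] [/= <- fCs _ noch dsC]]; last first.
  by have := perm_size noch; rewrite /= size_map.
rewrite cats0 in dsC.
have uCs : uniq (flatten Cs) by rewrite (perm_uniq dsC).
pose L := [seq [set x in C] | C <- Cs].
have orbits d C : C \in Cs -> d \in C -> porbit phi d = [set x in C].
  by move=> CsC dC; apply: porbit_fcycle => //; have /andP[] := allP fCs C CsC.
have uL : uniq L.
  rewrite /L; clear noch dsC L orbits; elim: Cs fCs uCs => //= C Cs IHCs.
  move=> /andP[/andP[C0 _] fCs]; rewrite cat_uniq => /and3P[_ disC uCs].
  rewrite IHCs // andbT; apply: contra disC => /mapP[C' CsC' /setP eqC].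
  case: C C0 eqC => // d C _ /(_ d); rewrite !inE eqxx => /esym dC'.
  apply/hasP; exists d; last exact: mem_head.
  by apply/flattenP; exists C'.
rewrite -(size_map (fun C => [set x in C])) -(card_uniqP uL).
apply: eq_card => B; apply/imsetP/mapP=> [[d]|[C CsC ->]].
  rewrite -(perm_mem dsC) => /flattenP[C CsC dC] ->.
  by exists C; rewrite // (orbits d C).
have /andP[C0 _] := allP fCs C CsC.
case: C CsC C0 => // d C CsC _; exists d.
  by rewrite -(perm_mem dsC); apply/flattenP; exists (d :: C); rewrite ?mem_head.
by rewrite (orbits d (d :: C)) ?mem_head.
Qed.
End FaceTracing.

Section Rotations.
Variables (G : sgraph) (vs : seq G) (nb : G -> seq G) (code : G -> N).
Hypothesis vs_uniq : uniq vs.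
Hypothesis vsG : vs =i G.
Hypothesis nb_uniq : forall v, uniq (nb v).
Hypothesis nbG : forall u v, (v \in nb u) = adjacent u v.
Implicit Types (rho : {ffun G -> {perm G}}) (s : seq G).

Lemma neighbours_seq v s : s =i nb v -> neighbours v = [set u in s].
Proof. by move=> sN; apply/setP=> u; rewrite !inE sN nbG. Qed.

(** The permutation at v is the successor function of the list s v, which fixes
    the vertices outside that list. *)
Lemma rotation_of_cycles (s : G -> seq G) :
  (forall v, uniq (s v)) -> (forall v, s v =i nb v) ->
  exists2 rho, rotation_system rho & forall v, fcycle (rho v) (s v).
Proof.
move=> us sN.
pose rho := [ffun v => perm (can_inj (prev_next (us v)))].
have rhoE v u : rho v u = next (s v) u by rewrite ffunE permE.
have cyc v : fcycle (rho v) (s v).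
  by rewrite (eq_fcycle (rhoE v)) cycle_next.
exists rho => //; apply/forallP=> v; rewrite (neighbours_seq (sN v)).
apply/andP; split.
  apply/subsetP=> u; rewrite !inE rhoE; apply: contraR => us'.
  by rewrite next_nth (negPf us').
apply/forall_inP=> u; rewrite inE => us'.
by rewrite (porbit_fcycle (cyc v) us').
Qed.

(** Three neighbours have only two cyclic orderings, inverse to each other. *)
Lemma rotation_cases rho v :
  cubic G -> rotation_system rho ->
  fcycle (rho v) (nb v) || fcycle (rho v) (rev (nb v)).
Proof.
move=> /forallP/(_ v) deg3 /forallP/(_ v)/andP[_ /forall_inP orb].
have Nv := neighbours_seq (fun u => erefl (u \in nb v)).
move: deg3 (nb_uniq v) orb; rewrite /degree Nv cardsE => /eqP.
move=> sz3 uN; move: sz3; rewrite (card_uniqP uN).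
case: (nb v) uN => [|a [|b [|c [|]]]] // uN _ orb.
have /orb/eqP orb_a : a \in [set u in [:: a; b; c]] by rewrite inE mem_head.
have card3 : #|porbit (rho v) a| = 3 by rewrite orb_a cardsE (card_uniqP uN).
have := uniq_traject_porbit (rho v) a; have := iter_porbit (rho v) a.
have := porbit_traject (rho v) a; rewrite card3 orb_a /=.
set p := rho v => mem3 paaa.
rewrite !inE !negb_or => /and3P[/andP[a_pa a_ppa] pa_ppa _].
move: (mem3 (p a)) (mem3 (p (p a))); rewrite !inE !eqxx !orbT /= ?orbT.
rewrite (eq_sym (p a) a) (negPf a_pa) (eq_sym (p (p a)) a) (negPf a_ppa) /=.
case/orP=> /eqP pa; rewrite pa in pa_ppa paaa *.
  rewrite (eq_sym (p b) b) (negPf pa_ppa) => /eqP pb.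
  by rewrite pb in paaa *; rewrite paaa !eqxx.
rewrite (eq_sym (p c) c) (negPf pa_ppa) orbF => /eqP pc.
by rewrite pc in paaa; rewrite /rev /= pc paaa !eqxx orbT.
Qed.

Definition dart_list : seq (G * G) := [seq (u, v) | u <- vs, v <- nb u].

Lemma dart_list_uniq : uniq dart_list.
Proof. by apply: allpairs_uniq_dep => // -[u v] [u' v'] _ _ /= [-> ->]. Qed.

Lemma mem_dart_list d : (d \in dart_list) = (d \in darts G).
Proof.
case: d => u v; rewrite inE /=.
apply/allpairsPdep/idP=> [[x [y [_ xy [-> ->]]]]|uv]; first by rewrite -nbG.
by exists u, v; rewrite vsG nbG.
Qed.

Definition dtrace : Type := trace (G * G)%type.

(** A face that enters v from p.1 leaves it towards the neighbour p.2 that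
    follows in the cyclic list s. *)
Definition turn (v : G) (s : seq G) (st : dtrace) : dtrace :=
  foldl (fun st p => link (p.1, v) (v, p.2) st) st (zip s (rot 1 s)).

Lemma traced_turn rho v s st :
  fcycle (rho v) s -> traced (face_perm rho) dart_list st ->
  traced (face_perm rho) dart_list (turn v s st).
Proof.
have zip_path x q y : path (frel (rho v)) x (rcons q y) ->
    all (fun p => rho v p.1 == p.2) (zip (x :: q) (rcons q y)).
  by elim: q x => [|z q IHq] x //= /andP[-> /IHq].
case: s => [|x q] //=; rewrite /turn rot1_cons => /zip_path.
elim: (zip _ _) st => //= p l IHl st /andP[/eqP vp all_l] tr_st.
apply: IHl => //; apply: traced_link => //; first exact: dart_list_uniq.
by rewrite permE /face_map /= vp.
Qed.

Definition embed (s : G -> seq G) : dtrace :=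
  foldl (fun st v => turn v (s v) st) (untraced dart_list) vs.

Lemma faces_card rho c :
  traced (face_perm rho) dart_list (c, [::]) -> #|faces rho| = c.
Proof.
move/(traced_card dart_list_uniq) <-; rewrite /faces.
apply: eq_card => B; apply/imsetP/imsetP=> -[d dD ->]; exists d => //.
  by rewrite mem_dart_list.
by rewrite -mem_dart_list.
Qed.

Lemma traced_embed rho (s : G -> seq G) :
  (forall v, fcycle (rho v) (s v)) ->
  traced (face_perm rho) dart_list (embed s).
Proof.
move=> cyc; rewrite /embed.
have : traced (face_perm rho) dart_list (untraced dart_list).
  exact: traced_untraced.
elim: vs (untraced _) => //= v ws IHws st tr_st.
by apply: IHws; apply: traced_turn.
Qed.

Definition trace_key (st : dtrace) : N :=
  digits code (flatten [seq [:: p.1.1; p.1.2; p.2.1; p.2.2] | p <- st.2]).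

Definition adjoin (q : N * dtrace) S :=
  if has (fun q' => if N.eqb q.1 q'.1 then q == q' else false) S then S
  else q :: S.

Definition distinct (S : seq (dtrace)) : seq (dtrace) :=
  unzip2 (foldr adjoin [::] [seq (trace_key st, st) | st <- S]).

Lemma mem_distinct S : distinct S =i S.
Proof.
have mem_adjoin L : foldr adjoin [::] L =i L.
  elim: L => //= q L IHL q'; rewrite [RHS]inE -IHL /adjoin.
  case: ifP => [/hasP[q2 q2L]|_]; last by rewrite inE.
  case: ifP => // _ /eqP->.
  by case: eqP => [->|].
move=> st; apply/mapP/idP=> [[q]|stS].
  by rewrite mem_adjoin => /mapP[st' stS ->] ->.
exists (trace_key st, st) => //; rewrite mem_adjoin.
exact: (map_f (fun st => (trace_key st, st))).
Qed.

(** The traces of all rotation systems, without repetition.  Duplicates are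
    removed after each vertex, before they multiply. *)
Definition embeddings : seq (dtrace) :=
  foldl (fun S v => distinct (flatten
           [seq [:: turn v (nb v) st; turn v (rev (nb v)) st] | st <- S]))
    [:: untraced dart_list] vs.

Lemma rotation_embedded rho :
  cubic G -> rotation_system rho ->
  exists2 st, st \in embeddings & traced (face_perm rho) dart_list st.
Proof.
move=> cG rot; rewrite /embeddings.
have: exists2 st, st \in [:: untraced dart_list]
    & traced (face_perm rho) dart_list st.
  by exists (untraced dart_list); rewrite ?mem_head //; apply: traced_untraced.
elim: vs [:: _] => //= v ws IHws S [st stS tr_st]; apply: IHws.
have [cyc|cyc] := orP (rotation_cases v cG rot).
  exists (turn v (nb v) st); last exact: traced_turn.
  by rewrite mem_distinct; apply/flatten_mapP; exists st; rewrite // mem_head.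
exists (turn v (rev (nb v)) st); last exact: traced_turn.
rewrite mem_distinct; apply/flatten_mapP; exists st; rewrite // !inE.
by rewrite eqxx orbT.
Qed.

Lemma genus_count0 g f :
  cubic G ->
  (forall rho, genus rho = g%:R%R -> #|faces rho| = f) ->
  all (fun st => (st.2 == [::]) && (st.1 != f)) embeddings ->
  genus_count G g = 0.
Proof.
move=> cG genus_f ok; apply/eqP; rewrite cards_eq0 -subset0.
apply/subsetP=> rho; rewrite inE => /andP[rot /eqP/genus_f faces_f].
have [st stS tr_st] := rotation_embedded cG rot.
have /andP[/eqP ch0 /eqP[]] := allP ok st stS.
by rewrite -faces_f; case: st ch0 tr_st {stS} => c ch /= -> /faces_card.
Qed.

Lemma genus_count_gt0 (s : G -> seq G) g f :
  (forall v, uniq (s v)) -> (forall v, s v =i nb v) ->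
  (forall rho : {ffun G -> {perm G}}, #|faces rho| = f -> genus rho = g%:R%R) ->
  embed s = (f, [::]) -> 0 < genus_count G g.
Proof.
move=> us sN genus_f emb; have [rho rot cyc] := rotation_of_cycles us sN.
apply/card_gt0P; exists rho; rewrite inE rot; apply/eqP/genus_f.
by apply: faces_card; rewrite -emb; apply: traced_embed.
Qed.
End Rotations.

Lemma genus_eq1 (G : sgraph) (rho : {ffun G -> {perm G}}) :
  #|G| = 16 -> (genus rho = 1%:R)%R <-> #|faces rho| = 8.
Proof.
move=> G16; rewrite /genus G16; split=> [g1|->]; last by apply/eqP.
apply/eqP; rewrite -(Num.Theory.eqr_nat rat); apply/eqP; lra.
Qed.

Lemma genus_polynomial_neq (G H : sgraph) g :
  #|G| = #|H| -> g < #|G|.+2 -> genus_count G g <> genus_count H g ->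
  genus_polynomial G <> genus_polynomial H.
Proof.
move=> GH g_G neq /(congr1 (fun p : {poly int} => p`_g)%R).
by rewrite !coef_poly -GH g_G => /eqP; rewrite Num.Theory.eqr_nat => /eqP.
Qed.

(** * The two graphs *)

(** A bare enumerated type, whose equality test is a mere case analysis: the
    searches below spend most of their time comparing vertices. *)
Inductive point :=
  v0 | v1 | v2 | v3 | v4 | v5 | v6 | v7
| v8 | v9 | v10 | v11 | v12 | v13 | v14 | v15.

Scheme Boolean Equality for point.

Lemma point_eqP : Equality.axiom point_beq.
Proof. by case; case; constructor. Qed.
HB.instance Definition _ := hasDecEq.Build point point_eqP.

Definition points : seq point :=
  [:: v0; v1; v2; v3; v4; v5; v6; v7; v8; v9; v10; v11; v12; v13; v14; v15].

Lemma point_indexK : cancel (index^~ points) (nth v0 points).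
Proof. by case. Qed.
HB.instance Definition _ : hasChoice point := CanHasChoice point_indexK.
HB.instance Definition _ : isCountable point := CanIsCountable point_indexK.

Lemma points_enum : Finite.axiom points.
Proof. by case. Qed.
HB.instance Definition _ := isFinite.Build point points_enum.

Lemma card_point : #|{: point}| = 16.
Proof. by rewrite cardT enumT unlock. Qed.

Lemma points_uniq : uniq points.
Proof. by []. Qed.

Lemma mem_points : points =i {: point}.
Proof. by case. Qed.

Definition point_code (v : point) : N := N.of_nat (index v points).

(** Besides the adjacency, these lists fix a reference cyclic ordering of the
    neighbours of each vertex. *)
Definition nbT (v : point) : seq point :=
  match v with
  | v0 => [:: v1; v3; v11] | v1 => [:: v0; v2; v4]
  | v2 => [:: v1; v3; v8] | v3 => [:: v0; v2; v5]
  | v4 => [:: v1; v5; v15] | v5 => [:: v3; v4; v6]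
  | v6 => [:: v5; v7; v10] | v7 => [:: v6; v8; v14]
  | v8 => [:: v2; v7; v9] | v9 => [:: v8; v10; v12]
  | v10 => [:: v6; v9; v13] | v11 => [:: v0; v12; v13]
  | v12 => [:: v9; v11; v15] | v13 => [:: v10; v11; v14]
  | v14 => [:: v7; v13; v15] | v15 => [:: v4; v12; v14]
  end.

Definition nbN (v : point) : seq point :=
  match v with
  | v0 => [:: v1; v5; v10] | v1 => [:: v0; v2; v4]
  | v2 => [:: v1; v3; v8] | v3 => [:: v2; v5; v6]
  | v4 => [:: v1; v5; v15] | v5 => [:: v0; v3; v4]
  | v6 => [:: v3; v7; v11] | v7 => [:: v6; v8; v14]
  | v8 => [:: v2; v7; v9] | v9 => [:: v8; v10; v12]
  | v10 => [:: v0; v9; v13] | v11 => [:: v6; v12; v13]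
  | v12 => [:: v9; v11; v15] | v13 => [:: v10; v11; v14]
  | v14 => [:: v7; v13; v15] | v15 => [:: v4; v12; v14]
  end.

Definition adjT (u v : point) : bool := v \in nbT u.
Definition adjN (u v : point) : bool := v \in nbN u.

Lemma adjT_sym : symmetric adjT. Proof. by case; case. Qed.
Lemma adjT_irrefl : irreflexive adjT. Proof. by case. Qed.
Lemma adjN_sym : symmetric adjN. Proof. by case; case. Qed.
Lemma adjN_irrefl : irreflexive adjN. Proof. by case. Qed.

Definition toroidal : sgraph := SGraph adjT_sym adjT_irrefl.
Definition nontoroidal : sgraph := SGraph adjN_sym adjN_irrefl.

Lemma nbT_uniq v : uniq (nbT v). Proof. by case: v. Qed.
Lemma nbN_uniq v : uniq (nbN v). Proof. by case: v. Qed.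

Lemma mem_nbT (u v : toroidal) : (v \in nbT u) = adjacent u v.
Proof. by []. Qed.
Lemma mem_nbN (u v : nontoroidal) : (v \in nbN u) = adjacent u v.
Proof. by []. Qed.

Lemma cubicT : cubic toroidal.
Proof.
apply/forallP=> v; rewrite /degree /neighbours cardsE.
by have /card_uniqP-> := nbT_uniq v; case: v.
Qed.

Lemma cubicN : cubic nontoroidal.
Proof.
apply/forallP=> v; rewrite /degree /neighbours cardsE.
by have /card_uniqP-> := nbN_uniq v; case: v.
Qed.

Lemma point_gt0 : 0 < #|{: point}|. Proof. by rewrite card_point. Qed.
Lemma point_gt4 : 4 < #|{: point}|. Proof. by rewrite card_point. Qed.

Lemma connectedT : connected (@adjacent toroidal).
Proof.
apply: (connected_by_spans (G := toroidal) (k := 6) mem_points mem_nbT)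
  point_gt0 _.
by vm_compute.
Qed.

Lemma connectedN : connected (@adjacent nontoroidal).
Proof.
apply: (connected_by_spans (G := nontoroidal) (k := 6) mem_points mem_nbN)
  point_gt0 _.
by vm_compute.
Qed.

Section Spectral.
Local Open Scope ring_scope.

Definition moved : seq point := [:: v2; v3; v4; v5; v9; v10; v11; v12].

Definition moved_row (u : point) : seq int :=
  match u with
  | v2 => [:: 3; 1; 2; - (1); 2; 1; - (1); - (2)]
  | v3 => [:: 1; 2; - (1); 3; - (1); 2; - (2); 1]
  | v4 => [:: 2; - (1); 3; 1; - (2); - (1); 1; 2]
  | v5 => [:: - (1); 3; 1; 2; 1; - (2); 2; - (1)]
  | v9 => [:: 2; - (1); - (2); 1; 3; - (1); 1; 2]
  | v10 => [:: 1; 2; - (1); - (2); - (1); 2; 3; 1]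
  | v11 => [:: - (1); - (2); 1; 2; 1; 3; 2; - (1)]
  | v12 => [:: - (2); 1; 2; - (1); 2; 1; - (1); 3]
  | _ => [::]
  end.

(** The integer matrices P with A P = P B form a lattice, A and B being the two
    adjacency matrices.  Lattice reduction yields this one, which is 5 times an
    orthogonal matrix.  It is 5 times the identity outside the rows and columns
    of the eight moved vertices: those of the two pentagons except 1 and 13. *)
Definition intertwiner (u v : point) : int :=
  if u \in moved then
    if v \in moved then nth 0 (moved_row u) (index v moved) else 0
  else if u == v then 5 else 0.

Lemma sum_points (f : point -> int) :
  \sum_y f y = foldr +%R 0 (map f points).
Proof.
rewrite (eq_bigl (mem points)) => [|v]; last by rewrite /= mem_points.
rewrite -big_uniq ?points_uniq //.
by elim: points => [|v s IHs]; rewrite ?big_nil ?big_cons //= IHs.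
Qed.

Lemma all_points2 (P : rel point) :
  all (fun x => all (P x) points) points -> forall x y, P x y.
Proof. by move=> /allP P_ x y; apply: (allP (P_ x _)); rewrite mem_points. Qed.

Lemma intertwiner_orth x z :
  \sum_y intertwiner x y * intertwiner z y = 25 *+ (x == z).
Proof.
rewrite sum_points; apply/eqP; move: x z; apply: all_points2.
by vm_compute.
Qed.

Lemma intertwiner_twines x z :
  \sum_y (adjT x y)%:R * intertwiner y z
    = \sum_y intertwiner x y * (adjN y z)%:R.
Proof.
rewrite !sum_points; apply/eqP; move: x z; apply: all_points2.
by vm_compute.
Qed.
End Spectral.

Lemma eq_diameter : diameter toroidal = diameter nontoroidal.
Proof.
rewrite (diameterE (G := toroidal) points_uniq mem_points mem_nbT).
rewrite (diameterE (G := nontoroidal) points_uniq mem_points mem_nbN).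
by rewrite card_point; vm_compute.
Qed.

Lemma vertex_connectivityT : vertex_connectivity toroidal = 3.
Proof.
apply: (vertex_connectivity3 (G := toroidal) (k := 6)
  mem_points mem_nbT cubicT point_gt4 connectedT).
by vm_compute.
Qed.

Lemma vertex_connectivityN : vertex_connectivity nontoroidal = 3.
Proof.
apply: (vertex_connectivity3 (G := nontoroidal) (k := 6)
  mem_points mem_nbN cubicN point_gt4 connectedN).
by vm_compute.
Qed.

Lemma edge_connectivityT : edge_connectivity toroidal = 3.
Proof.
apply: (edge_connectivity3 (G := toroidal) (k := 6)
  mem_points mem_nbT cubicT point_gt4 connectedT).
by vm_compute.
Qed.

Lemma edge_connectivityN : edge_connectivity nontoroidal = 3.
Proof.
apply: (edge_connectivity3 (G := nontoroidal) (k := 6)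
  mem_points mem_nbN cubicN point_gt4 connectedN).
by vm_compute.
Qed.

Lemma rigidT : #|automorphisms toroidal| = 1.
Proof.
apply: (rigid_by_copies (G := toroidal) points_uniq mem_points mem_nbT).
by vm_compute.
Qed.

Lemma rigidN : #|automorphisms nontoroidal| = 1.
Proof.
apply: (rigid_by_copies (G := nontoroidal) points_uniq mem_points mem_nbN).
by vm_compute.
Qed.

Lemma eq_cycle_count k :
  k <= 10 ->
  cycle_count (@adjacent toroidal) k = cycle_count (@adjacent nontoroidal) k.
Proof.
move=> k10; case: (ltnP k 3) => [k_lt3|k_ge3].
  by rewrite !cycle_count_small.
have k2_gt0 : 0 < 2 * k by rewrite muln_gt0 (leq_trans _ k_ge3).
apply/eqP; rewrite -(eqn_pmul2r k2_gt0).
rewrite (cycle_countE (G := toroidal) points_uniq mem_points nbT_uniq mem_nbT) //.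
rewrite (cycle_countE (G := nontoroidal)
  points_uniq mem_points nbN_uniq mem_nbN) //.
have : all (fun k => ucycle_count (G := toroidal) points nbT k ==
                     ucycle_count (G := nontoroidal) points nbN k) (iota 0 11).
  by vm_compute.
by move/allP; apply; rewrite mem_iota.
Qed.

(** The common girth is 4, so the searches for the least cycle length stop in
    the range where the cycle counts agree. *)
Lemma eq_girth : girth toroidal = girth nontoroidal.
Proof.
have c4 : 0 < cycle_count (@adjacent toroidal) 4.
  rewrite -(@ltn_pmul2r (2 * 4)) //.
  rewrite (cycle_countE (G := toroidal)
    points_uniq mem_points nbT_uniq mem_nbT (isT : 2 < 4)).
  by vm_compute.
rewrite /girth !card_point (iotaD 0 11 6) !find_cat.
set cT := fun k => 0 < _; set cN := fun k => 0 < _.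
have eq_c : {in iota 0 11, cT =1 cN}.
  by move=> k; rewrite mem_iota /cT => /eq_cycle_count->.
rewrite -(eq_in_has eq_c) -(eq_in_find eq_c).
by have -> : has cT (iota 0 11) by apply/hasP; exists 4.
Qed.

Lemma spanning_trees_toroidal :
  spanning_tree_count toroidal = N.to_nat 222293%num.
Proof.
apply: (spanning_tree_count_evaluated (G := toroidal) (code := point_code)
  (fp := 0%num) points_uniq mem_points nbT_uniq mem_nbT).
  exact: point_gt0.
by rewrite card_point; vm_compute.
Qed.

Lemma spanning_trees_nontoroidal :
  spanning_tree_count nontoroidal = N.to_nat 222293%num.
Proof.
apply: (spanning_tree_count_evaluated (G := nontoroidal) (code := point_code)
  (fp := 0%num) points_uniq mem_points nbN_uniq mem_nbN).
  exact: point_gt0.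
by rewrite card_point; vm_compute.
Qed.

(** The eight faces are the closed walks 0 1 2 3, 9 10 13 11 12, 6 7 14 13 10,
    2 8 7 6 5 3, 7 8 9 12 15 14, 0 3 5 4 15 12 11, 0 11 13 14 15 4 1 and
    1 4 5 6 10 9 8 2. *)
Definition torus_rotation (v : point) : seq point :=
  if v \in [:: v0; v3; v6; v7; v9; v11; v12] then rev (nbT v) else nbT v.

Lemma toroidal_genus1 : 0 < genus_count toroidal 1.
Proof.
apply: (genus_count_gt0 (G := toroidal) (s := torus_rotation) (f := 8)
  points_uniq mem_points nbT_uniq mem_nbT).
- by case.
- by case=> u; rewrite ?mem_rev.
- by move=> rho; rewrite genus_eq1 // card_point.
by vm_compute.
Qed.

Lemma nontoroidal_genus1 : genus_count nontoroidal 1 = 0.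
Proof.
apply: (genus_count0 (G := nontoroidal) (code := point_code) (f := 8)
  points_uniq mem_points nbN_uniq mem_nbN).
- exact: cubicN.
- by move=> rho; rewrite genus_eq1 // card_point.
by vm_compute.
Qed.

Lemma genus_polynomials_differ :
  genus_polynomial toroidal <> genus_polynomial nontoroidal.
Proof.
apply: (@genus_polynomial_neq toroidal nontoroidal 1) => //.
by rewrite nontoroidal_genus1 => eq0; have := toroidal_genus1; rewrite eq0.
Qed.

Theorem theoremB :
  (exists G H : sgraph,
     [/\ connected (@adjacent G), cubic G, connected (@adjacent H) & cubic H] /\
     (#|G| = 16 /\ #|H| = 16) /\
     perm_eq (adjacency_spectrum G) (adjacency_spectrum H) /\
     perm_eq (laplacian_spectrum G) (laplacian_spectrum H) /\
     spanning_tree_count G = spanning_tree_count H /\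
     girth G = girth H /\
     diameter G = diameter H /\
     vertex_connectivity G = vertex_connectivity H /\
     edge_connectivity G = edge_connectivity H /\
     #|automorphisms G| = #|automorphisms H| /\
     (forall k : nat, k <= 10 ->
        cycle_count (@adjacent G) k = cycle_count (@adjacent H) k) /\
     genus_polynomial G <> genus_polynomial H) /\
  ~ (forall G H : sgraph,
       connected (@adjacent G) -> cubic G ->
       connected (@adjacent H) -> cubic H ->
       perm_eq (adjacency_spectrum G) (adjacency_spectrum H) ->
       genus_polynomial G = genus_polynomial H).
Proof.
have cospectral :
    perm_eq (adjacency_spectrum toroidal) (adjacency_spectrum nontoroidal).
  exact: adjacency_cospectral intertwiner_orth intertwiner_twines.
split; last first.
  move=> determined; apply: genus_polynomials_differ.
  exact: determined connectedT cubicT connectedN cubicN cospectral.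
exists toroidal, nontoroidal; split.
  split; [exact: connectedT | exact: cubicT | exact: connectedN | exact: cubicN].
split; first by split; exact: card_point.
split; first exact: cospectral.
split.
  exact: (laplacian_cospectral _ intertwiner_orth intertwiner_twines cubicT cubicN).
split; first by rewrite spanning_trees_toroidal spanning_trees_nontoroidal.
split; first exact: eq_girth.
split; first exact: eq_diameter.
split; first by rewrite vertex_connectivityT vertex_connectivityN.
split; first by rewrite edge_connectivityT edge_connectivityN.
split; first by rewrite rigidT rigidN.
split; first exact: eq_cycle_count.
exact: genus_polynomials_differ.
Qed.
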